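(* The set $\mathfrak{X}_c^{\mathrm{supp}}$ of (strong equivalence classes of) compact metric full-support measure spaces, with the topology induced by the Gromov-Hausdorff-Prohorov metric $d_{\mathrm{GHP}}$, is a Polish space (although $d_{\mathrm{GHP}}$ restricted to $\mathfrak{X}_c^{\mathrm{supp}}$ is not complete).
   Context: A (pointed) compact metric measure space $(X,r,\rho,\mu)$ consists of a compact metric space $(X,r)$, a point $\rho\in X$ (the root) and a finite Borel measure $\mu$ on $X$. Two such spaces $(X,r,\rho,\mu)$, $(X',r',\rho',\mu')$ are strongly equivalent if there is a surjective isometry $\phi\colon X\to X'$ with $\phi(\rho)=\rho'$ and $\phi_*\mu=\mu'$. $\mathfrak{X}_c$ is the set of strong equivalence classes of compact metric measure spaces, and $\mathfrak{X}_c^{\mathrm{supp}}:=\{(X,r,\rho,\mu)\in\mathfrak{X}_c: X=\operatorname{supp}(\mu)\}$. The Gromov-Hausdorff-Prohorov metric on $\mathfrak{X}_c$ is $d_{\mathrm{GHP}}(\mathcal{X},\mathcal{X}'):=\inf_d\big(d_{\mathrm{Pr}}^{(X\sqcup X',d)}(\mu,\mu')+d_{\mathrm H}^{(X\sqcup X',d)}(X,X')+d(\rho,\rho')\big)$, the infimum being over all metrics $d$ on the disjoint union $X\sqcup X'$ extending both $r$ and $r'$, where $d_{\mathrm{Pr}}$ is the Prohorov metric on finite measures, $d_{\mathrm{Pr}}(\mu,\mu')=\inf\{\varepsilon>0:\mu(A)\le\mu'(A^\varepsilon)+\varepsilon,\ \mu'(A)\le\mu(A^\varepsilon)+\varepsilon\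 \forall A\text{ closed}\}$ with $A^\varepsilon=\{x:d(x,A)\le\varepsilon\}$, and $d_{\mathrm H}$ is the Hausdorff distance. *)

(* Defs.v *)
From HB Require Import structures.
From mathcomp Require Import all_boot all_order all_algebra.
From mathcomp Require Import generic_quotient.
From mathcomp Require Import all_classical all_reals all_analysis.

Set Implicit Arguments.
Unset Strict Implicit.
Unset Printing Implicit Defensive.

Import Order.TTheory GRing.Theory Num.Theory.
Import numFieldNormedType.Exports.

Local Open Scope classical_set_scope.
Local Open Scope ring_scope.
Local Open Scope quotient_scope.

(* ** Distance functions *)

Section distance_functions.
Context {R : realType} {T : Type}.
Implicit Types (d : T -> T -> R) (A B : set T) (m : set T -> \bar R).

Record is_metric d : Prop := IsMetric {
  is_metric_xx : forall x, d x x = 0 ;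
  is_metric_positivity : forall x y, d x y = 0 -> x = y ;
  is_metric_sym : forall x y, d x y = d y x ;
  is_metric_triangle : forall y x z, d x z <= d x y + d y z }.

Definition cauchy_for d (u : nat -> T) :=
  forall e, 0 < e -> \forall m & n \near \oo, d (u m) (u n) < e.

Definition complete_for d := forall u : nat -> T, cauchy_for d u ->
  exists l : T, d (u n) l @[n --> \oo] --> (0 : R).

Definition closed_for d A :=
  forall x, (forall e, 0 < e -> exists2 a, A a & d x a < e) -> A x.

(* The set A^e of points at distance at most e from A. The distance to set0 is
   the infimum of the empty set in \bar R, namely +oo, so set0^e = set0. *)
Definition fattening d A (e : R) : set T :=
  [set x | (ereal_inf [set (d x a)%:E | a in A] <= e%:E)%E].

Definition prohorov d m1 m2 : R :=
  inf [set e : R | 0 < e /\ forall A, closed_for d A ->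
    (m1 A <= m2 (fattening d A e) + e%:E)%E /\
    (m2 A <= m1 (fattening d A e) + e%:E)%E].

Definition hausdorff_dist d A B : R :=
  inf [set e : R | [/\ 0 < e, A `<=` fattening d B e & B `<=` fattening d A e]].

End distance_functions.

(* ** Polish spaces *)

Definition separable (T : topologicalType) :=
  exists2 S : set T, countable S & dense S.

Definition metrizes (R : realType) (T : topologicalType) (d : T -> T -> R) :=
  is_metric d /\ forall x : T,
    nbhs x = filter_from [set e : R | 0 < e] (fun e => [set y | d x y < e]).

Definition polish (R : realType) (T : topologicalType) :=
  separable T /\ exists2 d : T -> T -> R, metrizes d & complete_for d.

(* ** Pointed compact metric measure spaces *)

#[short(type="pmetricType")]
HB.structure Definition PointedMetric (K : numDomainType) :=
  { M of Metric K M & isPointed M }.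

Notation borel X := (g_sigma_algebraType (@open X)).

(* The root of the space is its distinguished element [point]. *)
Record cmms (R : realType) := CMMS {
  cmms_sort :> pmetricType R ;
  cmms_compact : compact [set: cmms_sort] ;
  cmms_measure : {finite_measure set (borel cmms_sort) -> \bar R} }.

Section strong_equivalence.
Context {R : realType}.
Implicit Types X Y Z : cmms R.

(* Measures are functions on all subsets that are only meaningful on the
   measurable ones, so measures are compared on Borel sets only. *)
Definition strong_equiv X Y := exists phi : X -> Y,
  [/\ forall y, exists x, phi x = y,
      forall x1 x2, mdist (phi x1) (phi x2) = mdist x1 x2,
      phi point = point &
      forall A : set (borel Y), measurable A ->
        cmms_measure X (phi @^-1` A) = cmms_measure Y A].

Lemma isometry_preimage_borel X Y (phi : X -> Y) (A : set (borel Y)) :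
  (forall x1 x2, mdist (phi x1) (phi x2) = mdist x1 x2) ->
  measurable A -> measurable (phi @^-1` A : set (borel X)).
Proof.
move=> phi_iso mA.
have phi_cont : continuous phi.
  move=> x; apply/metricType_numDomainType.cvgrPdist_lt => e e0.
  near=> y; rewrite phi_iso; near: y.
  by apply/metricType_numDomainType.nbhs_mdistP; exists e.
suff phi_meas : measurable_fun [set: borel X] (phi : borel X -> borel Y).
  by rewrite -[_ @^-1` _]setTI; exact: phi_meas.
apply: (@measurability _ _ (borel X) (borel Y) setT phi (@open Y)) => //.
move=> _ [B oB <-]; rewrite setTI; apply: sub_sigma_algebra.
by move/continuousP : phi_cont; exact.
Unshelve. all: by end_near. Qed.

Lemma strong_equiv_refl X : strong_equiv X X.
Proof. by exists id; split=> // y; exists y. Qed.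

Lemma strong_equiv_sym X Y : strong_equiv X Y -> strong_equiv Y X.
Proof.
move=> [phi [phi_surj phi_iso phi_pt phi_mu]].
have [psi psiK] := choice phi_surj.
have phi_inj : injective phi.
  by move=> x y xy; apply: mdist_positivity; rewrite -phi_iso xy mdistxx.
have phiK : cancel phi psi by move=> x; apply: phi_inj; rewrite psiK.
have psi_iso y1 y2 : mdist (psi y1) (psi y2) = mdist y1 y2.
  by rewrite -phi_iso !psiK.
exists psi; split=> //.
- by move=> x; exists (phi x).
- by rewrite -phi_pt phiK.
- move=> A mA; rewrite -phi_mu.
    by rewrite -comp_preimage (_ : psi \o phi = id)//; exact/funext.
  exact: isometry_preimage_borel.
Qed.

Lemma strong_equiv_trans X Y Z :
  strong_equiv X Y -> strong_equiv Y Z -> strong_equiv X Z.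
Proof.
move=> [f [f_surj f_iso f_pt f_mu]] [g [g_surj g_iso g_pt g_mu]].
exists (g \o f); split=> /=.
- by move=> z; have [y <-] := g_surj z; have [x <-] := f_surj y; exists x.
- by move=> x1 x2; rewrite g_iso f_iso.
- by rewrite f_pt.
- move=> A mA; rewrite -g_mu// comp_preimage -f_mu//.
  exact: isometry_preimage_borel.
Qed.

End strong_equivalence.

HB.instance Definition _ (R : realType) := gen_eqMixin (cmms R).
HB.instance Definition _ (R : realType) := gen_choiceMixin (cmms R).

Definition strong_eq (R : realType) : rel (cmms R) :=
  fun X Y => `[< strong_equiv X Y >].

Lemma strong_eq_refl R : reflexive (@strong_eq R).
Proof. by move=> X; apply/asboolP; exact: strong_equiv_refl. Qed.

Lemma strong_eq_sym R : symmetric (@strong_eq R).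
Proof. by move=> X Y; apply: asbool_equiv_eq; split; exact: strong_equiv_sym. Qed.

Lemma strong_eq_trans R : transitive (@strong_eq R).
Proof.
move=> Y X Z /asboolP XY /asboolP YZ; apply/asboolP.
exact: strong_equiv_trans XY YZ.
Qed.

Canonical strong_eq_equiv (R : realType) :=
  EquivRel (@strong_eq R) (@strong_eq_refl R) (@strong_eq_sym R)
    (@strong_eq_trans R).

Definition Xc (R : realType) := {eq_quot strong_eq_equiv R}.

HB.instance Definition _ (R : realType) := Choice.on (Xc R).

(* ** The Gromov-Hausdorff-Prohorov distance *)

Section ghp.
Context {R : realType}.

Definition extending_metric (X Y : cmms R) (d : X + Y -> X + Y -> R) :=
  [/\ is_metric d,
      forall x1 x2, d (inl x1) (inl x2) = mdist x1 x2 &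
      forall y1 y2, d (inr y1) (inr y2) = mdist y1 y2].

(* The measures of X and Y are transported to the disjoint union X + Y by the
   canonical injections. *)
Definition ghp_rep (X Y : cmms R) : R :=
  inf [set prohorov d (fun A => cmms_measure X (inl @^-1` A))
                      (fun A => cmms_measure Y (inr @^-1` A))
           + hausdorff_dist d (range inl) (range inr)
           + d (inl point) (inr point)
      | d in @extending_metric X Y].

(* [ghp_rep] is invariant under strong equivalence, so the choice of
   representatives is irrelevant. *)
Definition ghp (x y : Xc R) : R := ghp_rep (repr x) (repr y).

Definition ghp_open : set_system (Xc R) :=
  [set U | forall x, U x -> exists2 e : R, 0 < e & [set y | ghp x y < e] `<=` U].

Let ghp_openT : ghp_open setT.
Proof. by move=> x _; exists 1. Qed.

Let ghp_openI : setI_closed ghp_open.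
Proof.
move=> U V oU oV x [/oU[e e0 eU] /oV[f f0 fV]].
exists (Num.min e f); first by rewrite lt_min e0.
by move=> y /=; rewrite lt_min => /andP[/eU ? /fV].
Qed.

Let ghp_open_bigU (I : Type) (f : I -> set (Xc R)) :
  (forall i, ghp_open (f i)) -> ghp_open (\bigcup_i f i).
Proof.
move=> of_ x [i _ /of_[e e0 ef]]; exists e => //.
by apply: subset_trans ef _; exact: bigcup_sup.
Qed.

HB.instance Definition _ :=
  isOpenTopological.Build (Xc R) ghp_openT ghp_openI ghp_open_bigU.

End ghp.

Definition measure_support (R : realType) (X : cmms R) : set X :=
  [set x | forall U : set X, open U -> U x -> (0 < cmms_measure X U)%E].
Arguments measure_support {R} X.

(* As a type, this subset carries the topology induced by that of [Xc R]. *)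
Definition Xc_supp (R : realType) : set (Xc R) :=
  [set x : Xc R | measure_support (repr x) = setT].
Arguments Xc_supp R : clear implicits.

(* Main.v *)
(* A correspondence C between X and Y with distortion at most 2e, which relates
   the roots and satisfies mu(A) <= nu(C[A]) + e and nu(B) <= mu(C^-1[B]) + e on
   closed sets, yields a metric on X + Y witnessing d_GHP <= 3e; conversely
   d_GHP < e yields such a C. Correspondences compose, which replaces the triangle
   inequality of d_GHP. If they exist for all e > 0, ultrafilter limits of
   selections give an isometry carrying mu to nu.
   Given correspondences C_n of summable size between X_n and X_(n+1), the
   sequences t with C_n (t n) (t n.+1) for all n form a compact subset of the
   product; identifying those at limit distance 0 gives a limit space, and the
   masses of the n-th coordinates of a closed set converge to a content, which
   extends to a Borel measure.
   Full support means that certain functions [spread k], 1-Lipschitz for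
   correspondences, are all positive; adding the differences of their inverses
   to the distance makes the open conditions [0 < spread k] complete.
   One-point spaces of mass 1/n show that d_GHP itself is not complete. *)
From HB Require Import structures.
Require Import Defs.
From mathcomp Require Import all_boot all_order all_algebra.
From mathcomp Require Import generic_quotient.
From mathcomp Require Import all_classical all_reals all_analysis.
From mathcomp Require Import lra.

Set Implicit Arguments.
Unset Strict Implicit.
Unset Printing Implicit Defensive.

Import Order.TTheory GRing.Theory Num.Theory.
Import numFieldNormedType.Exports.

Local Open Scope classical_set_scope.
Local Open Scope ring_scope.

(** * Correspondences *)

Section metric_spaces.
Context {R : realType}.

(** Gluing would require metrics on unions of three and then infinitely many spaces, whereas the
    sizes of relations just add. Measures have a meaning on Borel sets only, which is why relations
    are required to map closed sets to closed sets and why masses are compared on closed sets. Full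
    support is a G_delta condition, and the remetrization is that of Alexandrov's theorem on G_delta
    subsets of complete spaces: a Cauchy sequence first gets a limit among all compact measure
    spaces, and a bound on inverse spreads then shows that this limit has full support. A recurrent
    side condition is that the infimum of an empty set of reals is 0, so that sets of candidates
    must be shown nonempty before an infimum says anything. *)

Lemma nbhs_mdist (T : metricType R) (x : T) (e : R) :
  0 < e -> nbhs x [set y | mdist x y < e].
Proof. by move=> e0; apply/metricType_numDomainType.nbhs_mdistP; exists e. Qed.

Lemma closed_mdistP (T : metricType R) (A : set T) :
  closed A <-> closed_for mdist A.
Proof.
split=> [cA x Ax|cA x Ax].
  apply: cA => U /metricType_numDomainType.nbhs_mdistP[e /= e0 eU].
  by have [a Aa xa] := Ax _ e0; exists a; split => //; exact: eU.
by apply: cA => e e0; have [a [Aa xa]] := Ax _ (nbhs_mdist x e0); exists a.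
Qed.

Lemma closed_mdist_le (T : metricType R) (x : T) (r : R) :
  closed [set y | mdist x y <= r].
Proof.
apply/closed_mdistP => y /= xy; apply/ler_addgt0Pr => e e0.
have [z /= xz yz] := xy _ e0.
by rewrite (le_trans (metric_triangle _ z _))// lerD// metric_sym ltW.
Qed.

(** If [f] stayed above [e], compactness would give a uniform gap [1 / (n + 1)] on [A]. This is how
    images of closed sets under metrically defined relations are seen to be closed. *)
Lemma compact_attains (T : metricType R) (A : set T) (f : T -> R) (e : R) :
  compact A -> (forall x y, f x <= f y + mdist x y) ->
  (forall d, 0 < d -> exists2 a, A a & f a <= e + d) ->
  exists2 a, A a & f a <= e.
Proof.
move=> cA fL fA; apply: contrapT => nA.
have fgt a : A a -> e < f a by move=> Aa; rewrite ltNge; apply/negP => ?; apply: nA; exists a.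
have /compact_near_coveringP/(_ _ \oo (fun n a => e + n.+1%:R^-1 < f a) _) := cA.
case=> [a Aa|n _ /(_ n (leqnn n)) nf].
  pose d := (f a - e) / 2; have d0 : 0 < d by rewrite divr_gt0// subr_gt0 fgt.
  exists ([set b | mdist a b < d], [set n | n.+1%:R^-1 < d]) => /=.
    split; first exact: nbhs_mdist.
    exact: (near_infty_natSinv_lt (PosNum d0)).
  move=> [b n]/= [ab nd]; have := fL a b.
  rewrite -lerBlDr; apply: lt_le_trans; rewrite ltrBrDl.
  rewrite (_ : f a = e + (d + d)); last by rewrite /d -splitr addrC subrK.
  by rewrite addrCA ltrD2l addrC ltrD.
have n0 : (0 : R) < n.+1%:R^-1 by rewrite invr_gt0.
by have [a /nf/= + fa] := fA _ n0; rewrite ltNge fa.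
Qed.

Lemma compact_diam (T : metricType R) : T -> compact [set: T] ->
  exists M : R, forall x y : T, mdist x y <= M.
Proof.
move=> p cT.
have /compact_near_coveringP/(_ _ (pinfty_nbhs R) (fun r x => mdist p x <= r) _) := cT.
case=> [x _|M [_ +]].
  exists ([set y | mdist x y < 1], [set r | mdist p x + 1 < r]) => /=.
    by split; [exact: nbhs_mdist|exists (mdist p x + 1); rewrite num_real].
  move=> [y r]/= [xy xr]; rewrite (le_trans (metric_triangle _ x _))//.
  by rewrite (le_trans _ (ltW xr))// lerD2l ltW.
move=> /(_ (M + 1)); rewrite ltrDl => /(_ ltr01) Mp.
exists ((M + 1) + (M + 1)) => x y; rewrite (le_trans (metric_triangle _ p _))//.
by rewrite lerD// ?(metric_sym x); exact: Mp.
Qed.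

End metric_spaces.

Lemma measurable_closed (R : realType) (X : cmms R) (A : set X) :
  closed A -> measurable (A : set (borel X)).
Proof.
move=> cA; rewrite -(setCK A); apply: measurableC.
by apply: sub_sigma_algebra; exact: closed_openC.
Qed.
Arguments measurable_closed {R} X {A}.

Section correspondences.
Context {R : realType}.
Implicit Types X Y Z : cmms R.

Definition rel_image X Y (C : X -> Y -> Prop) (A : set X) : set Y :=
  [set y | exists2 x, A x & C x y].

(** One direction only, so that an estimate can be proved once and applied to a relation and to its
    converse. Two pairs of points at distance at most [e] in a common space account for the [2 * e].
    Closedness of images is a field because it makes the mass condition meaningful and passes to
    composites. *)
Record half_corr (e : R) X Y (C : X -> Y -> Prop) : Prop := HalfCorr {
  corr_root : C point point ;
  corr_total : forall x, exists y, C x y ;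
  corr_dist : forall x x' y y', C x y -> C x' y' ->
    mdist x x' <= mdist y y' + 2 * e ;
  corr_closed : forall A, closed A -> closed (rel_image C A) ;
  corr_mass : forall A, closed A ->
    (cmms_measure X A <= cmms_measure Y (rel_image C A) + e%:E)%E }.

Definition correspondence e X Y (C : X -> Y -> Prop) :=
  half_corr e C /\ half_corr e (fun y x => C x y).

Definition approx e X Y := exists C : X -> Y -> Prop, correspondence e C.

Lemma cmms_closed_compact X (A : set X) : closed A -> compact A.
Proof. by move=> cA; exact: subclosed_compact cA (@cmms_compact R X) _. Qed.

Lemma le_measure_borel X (A B : set X) :
  measurable (A : set (borel X)) -> measurable (B : set (borel X)) ->
  A `<=` B -> (cmms_measure X A <= cmms_measure X B)%E.
Proof.
move=> mA mB AB.
by apply: (@le_measure _ _ (borel X) (cmms_measure X) A B); rewrite ?inE.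
Qed.

Lemma cmms_le X (A B : set X) : closed A -> closed B -> A `<=` B ->
  (cmms_measure X A <= cmms_measure X B)%E.
Proof. by move=> cA cB; apply: le_measure_borel; exact: (measurable_closed X). Qed.

Lemma approx_sym e X Y : approx e X Y -> approx e Y X.
Proof. by move=> [C [C1 C2]]; exists (fun y x => C x y). Qed.

Lemma rel_image_comp X Y Z (C : X -> Y -> Prop) (D : Y -> Z -> Prop) A :
  rel_image (fun x z => exists2 y, C x y & D y z) A =
  rel_image D (rel_image C A).
Proof.
apply/seteqP; split=> [z [x Ax [y Cxy Dyz]]|z [y [x Ax Cxy] Dyz]].
  by exists y => //; exists x.
by exists x => //; exists y.
Qed.

Lemma half_corr_comp e f X Y Z (C : X -> Y -> Prop) (D : Y -> Z -> Prop) :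
  half_corr e C -> half_corr f D ->
  half_corr (e + f) (fun x z => exists2 y, C x y & D y z).
Proof.
move=> hC hD; split.
- by exists point; [exact: corr_root hC|exact: corr_root hD].
- by move=> x; have [y Cxy] := corr_total hC x; have [z] := corr_total hD y; exists z, y.
- move=> x x' z z' [y Cxy Dyz] [y' Cxy' Dyz'].
  have := corr_dist hC Cxy Cxy'; have := corr_dist hD Dyz Dyz'; lra.
- by move=> A cA; rewrite rel_image_comp; exact/(corr_closed hD)/(corr_closed hC).
- move=> A cA; rewrite rel_image_comp.
  apply: (le_trans (corr_mass hC cA)); rewrite (addrC e) EFinD addeA leeD2r//.
  exact/(corr_mass hD)/(corr_closed hC).
Qed.

Lemma approx_trans e f X Y Z :
  approx e X Y -> approx f Y Z -> approx (e + f) X Z.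
Proof.
move=> [C [C1 C2]] [D [D1 D2]]; exists (fun x z => exists2 y, C x y & D y z).
split; first exact: half_corr_comp.
rewrite addrC (_ : (fun _ => _) =
  fun z x => exists2 y, (fun z y => D y z) z y & (fun y x => C x y) y x).
  exact: half_corr_comp.
by apply/funext => z; apply/funext => x; apply/propext; split=> -[y ? ?]; exists y.
Qed.

Lemma approx_le e f X Y : e <= f -> approx e X Y -> approx f X Y.
Proof.
move=> ef [C [C1 C2]]; exists C.
have mono (U V : cmms R) (D : U -> V -> Prop) : half_corr e D -> half_corr f D.
  move=> hD; split; [exact: corr_root hD|exact: corr_total hD| |
    exact: corr_closed hD|].
  - move=> x x' y y' Dxy Dxy'; have := corr_dist hD Dxy Dxy'; lra.
  - by move=> A cA; rewrite (le_trans (corr_mass hD cA))// leeD2l// lee_fin.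
by split; exact: mono.
Qed.

Lemma isometry_continuous X Y (phi : X -> Y) :
  (forall x1 x2, mdist (phi x1) (phi x2) = mdist x1 x2) -> continuous phi.
Proof.
move=> phi_iso x; apply/metricType_numDomainType.cvgrPdist_lt => e e0.
near=> y; rewrite phi_iso; near: y; exact: nbhs_mdist.
Unshelve. all: by end_near. Qed.

Lemma isometry_image_closed X Y (phi : X -> Y) (A : set X) :
  (forall x1 x2, mdist (phi x1) (phi x2) = mdist x1 x2) ->
  closed A -> closed (phi @` A).
Proof.
move=> phi_iso cA; apply: compact_closed; first exact: metric_hausdorff.
apply: continuous_compact; last exact: cmms_closed_compact.
exact/continuous_subspaceT/isometry_continuous.
Qed.

Lemma strong_equiv_approx e X Y : 0 <= e -> strong_equiv X Y -> approx e X Y.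
Proof.
move=> e0 [phi [phi_surj phi_iso phi_pt phi_mu]].
have phi_inj : injective phi.
  by move=> x y xy; apply: mdist_positivity; rewrite -phi_iso xy mdistxx.
have imE A : rel_image (fun x y => phi x = y) A = phi @` A.
  by apply/seteqP; split=> y [x Ax xy]; exists x.
have preE B : rel_image (fun y x => phi x = y) B = phi @^-1` B.
  by apply/seteqP; split=> [x [y By xy]|x Bx]; [rewrite /preimage/= xy|exists (phi x)].
have im_closed A : closed A -> closed (phi @` A) by exact: isometry_image_closed.
exists (fun x y => phi x = y); split; split => //.
- by move=> x; exists (phi x).
- by move=> x x' y y' <- <-; rewrite phi_iso; lra.
- move=> A cA; rewrite imE -phi_mu; last first.
    by apply: (measurable_closed Y); exact: im_closed.
  rewrite (_ : _ @^-1` _ = A) ?leeDl//.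
  by apply/seteqP; split=> [x [x' Ax' /phi_inj <-]//|x Ax]; exists x.
- by move=> x x' y y' <- <-; rewrite phi_iso; lra.
- move=> B cB; rewrite preE; apply: preimage_closed cB => //.
  by move=> x _; exact: isometry_continuous.
- move=> B cB; rewrite preE phi_mu ?leeDl//; exact: (measurable_closed Y).
Qed.

Lemma cmms_fin X (A : set X) : measurable (A : set (borel X)) ->
  cmms_measure X A \is a fin_num.
Proof. by move=> mA; exact: fin_num_measure. Qed.

(** The full relation works once [e] exceeds both diameters and both total masses. This keeps infima
    over sizes or over extending metrics off the empty set. *)
Lemma approx_ex X Y : exists2 e, 0 < e & approx e X Y.
Proof.
have [M XM] := compact_diam point (@cmms_compact R X).
have [N YN] := compact_diam point (@cmms_compact R Y).
have finX := @cmms_fin X setT (measurableT : measurable (setT : set (borel X))).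
have finY := @cmms_fin Y setT (measurableT : measurable (setT : set (borel Y))).
have M0 : 0 <= M by rewrite (le_trans (mdist_ge0 (point : X) point)).
have N0 : 0 <= N by rewrite (le_trans (mdist_ge0 (point : Y) point)).
have m0 : 0 <= fine (cmms_measure X setT) by rewrite fine_ge0.
have n0 : 0 <= fine (cmms_measure Y setT) by rewrite fine_ge0.
pose e := 1 + M + N + fine (cmms_measure X setT) + fine (cmms_measure Y setT).
have closed_im (U V : cmms R) (A : set U) : closed (@rel_image U V (fun _ _ => True) A).
  have [->|/set0P[a Aa]] := eqVneq A set0.
    suff -> : @rel_image U V (fun _ _ => True) set0 = set0 by exact: closed0.
    by apply/seteqP; split=> // y [].
  suff -> : @rel_image U V (fun _ _ => True) A = setT by exact: closedT.
  by apply/seteqP; split=> // y _; exists a.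
exists e; first by rewrite /e; lra.
exists (fun _ _ => True); split; split => //.
- by exists point.
- by move=> x x' y y' _ _; have := XM x x'; have := mdist_ge0 y y'; rewrite /e; lra.
- move=> A cA; rewrite (le_trans (cmms_le cA closedT (@subsetT _ _)))//.
  rewrite -(fineK finX) (le_trans _ (leeDr _ _))// lee_fin /e; lra.
- by exists point.
- by move=> x x' y y' _ _; have := YN x x'; have := mdist_ge0 y y'; rewrite /e; lra.
- move=> A cA; rewrite (le_trans (cmms_le cA closedT (@subsetT _ _)))//.
  rewrite -(fineK finY) (le_trans _ (leeDr _ _))// lee_fin /e; lra.
Qed.

End correspondences.

(** * Comparison with the Gromov-Hausdorff-Prohorov distance *)

Section ghp_approx.
Context {R : realType}.
Implicit Types X Y Z : cmms R.

Lemma fattening_le (T : Type) (d : T -> T -> R) A e x a :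
  A a -> d x a <= e -> fattening d A e x.
Proof.
by move=> Aa xa; apply: ge_ereal_inf; exists (d x a)%:E; [exists a|rewrite lee_fin].
Qed.

(** The infimum in [fattening] need not be attained, hence all radii above [e]. For empty [A] it is
    [+oo] and both sides fail. *)
Lemma fatteningP (T : Type) (d : T -> T -> R) A e x :
  fattening d A e x <-> forall f, e < f -> exists2 a, A a & d x a < f.
Proof.
split=> [Aex f ef|Aex].
  have : (ereal_inf [set (d x a)%:E | a in A] < f%:E)%E.
    by apply: le_lt_trans Aex _; rewrite lte_fin.
  by move=> /ereal_inf_lt[_ [a Aa <-]]; rewrite lte_fin; exists a.
rewrite /fattening/=; apply/lee_addgt0Pr => f f0.
have [|a Aa xa] := Aex (e + f); first by rewrite ltrDl.
by apply: ge_ereal_inf; exists (d x a)%:E; [exists a|rewrite -EFinD lee_fin ltW].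
Qed.

Lemma fattening_preimage_closed X (T : Type) (d : T -> T -> R) (h : X -> T) A e :
  is_metric d -> (forall x y, d (h x) (h y) = mdist x y) ->
  closed (h @^-1` fattening d A e).
Proof.
move=> md hd; apply/closed_mdistP => x xA; apply/fatteningP => f ef.
have fe : 0 < (f - e) / 2 by lra.
have [y /fatteningP yA xy] := xA _ fe.
have [|a Aa ya] := yA (e + (f - e) / 2); first by lra.
exists a => //; have := is_metric_triangle md (h y) (h x) a; rewrite hd; lra.
Qed.

Lemma preimage_closed_for X (T : Type) (d : T -> T -> R) (h : X -> T) A :
  (forall x y, d (h x) (h y) = mdist x y) ->
  closed_for d A -> closed (h @^-1` A).
Proof.
move=> hd cA; apply/closed_mdistP => x xA; apply: cA => e /xA[a Aa xa].
by exists (h a) => //; rewrite hd.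
Qed.

Section cross_distance.
Context X Y (C : X -> Y -> Prop) (e : R).
Hypothesis (e0 : 0 < e) (corrC : correspondence e C).

(** The usual gluing along a correspondence: a crossing costs [e], so the two crossings of a detour
    pay for the distortion [2 * e], and the two sides stay at positive distance. *)
Definition cross (x : X) (y : Y) : R :=
  inf [set r | exists u v, C u v /\ r = mdist x u + e + mdist v y].

Let crossS_lb x y :
  lbound [set r | exists u v, C u v /\ r = mdist x u + e + mdist v y] e.
Proof.
move=> _ [u [v [_ ->]]]; have := mdist_ge0 x u; have := mdist_ge0 v y; lra.
Qed.

Let crossS_nonempty x y :
  [set r | exists u v, C u v /\ r = mdist x u + e + mdist v y] !=set0.
Proof.
exists (mdist x point + e + mdist point y), point, point; split=> //.
exact: corr_root corrC.1.
Qed.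

Let cross_ge x y : e <= cross x y.
Proof. exact: lb_le_inf. Qed.

Let cross_le x y u v : C u v -> cross x y <= mdist x u + e + mdist v y.
Proof. by move=> Cuv; apply: ge_inf; [exists e|exists u, v]. Qed.

Let cross_lt x y f : cross x y < f ->
  exists u v, C u v /\ mdist x u + e + mdist v y < f.
Proof. by case/(inf_lt (crossS_nonempty x y)) => _ [u [v [Cuv ->]]]; exists u, v. Qed.

Let cross_trl x x' y : cross x y <= mdist x x' + cross x' y.
Proof.
apply/ler_addgt0Pr => f f0.
have [u [v [Cuv uv]]] := @cross_lt x' y (cross x' y + f) ltac:(lra).
have := cross_le x y Cuv; have := metric_triangle x x' u; lra.
Qed.

Let cross_trr x y y' : cross x y <= cross x y' + mdist y' y.
Proof.
apply/ler_addgt0Pr => f f0.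
have [u [v [Cuv uv]]] := @cross_lt x y' (cross x y' + f) ltac:(lra).
have := cross_le x y Cuv; have := metric_triangle v y' y; lra.
Qed.

Let cross_triX x x' y : mdist x x' <= cross x y + cross x' y.
Proof.
apply/ler_addgt0Pr => f f0; have f20 : 0 < f / 2 by lra.
have [u [v [Cuv uv]]] := @cross_lt x y (cross x y + f / 2) ltac:(lra).
have [u' [v' [Cuv' uv']]] := @cross_lt x' y (cross x' y + f / 2) ltac:(lra).
have := metric_triangle x u x'; have := metric_triangle u u' x'.
have := corr_dist corrC.1 Cuv Cuv'; have := metric_triangle v y v'.
rewrite (metric_sym u' x') (metric_sym y v'); lra.
Qed.

Let cross_triY x y y' : mdist y y' <= cross x y + cross x y'.
Proof.
apply/ler_addgt0Pr => f f0; have f20 : 0 < f / 2 by lra.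
have [u [v [Cuv uv]]] := @cross_lt x y (cross x y + f / 2) ltac:(lra).
have [u' [v' [Cuv' uv']]] := @cross_lt x y' (cross x y' + f / 2) ltac:(lra).
have := metric_triangle y v y'; have := metric_triangle v v' y'.
have := corr_dist corrC.2 Cuv Cuv'; have := metric_triangle u x u'.
rewrite (metric_sym y v) (metric_sym u x); lra.
Qed.

Definition sum_dist (z w : X + Y) : R :=
  match z, w with
  | inl x, inl x' => mdist x x'
  | inr y, inr y' => mdist y y'
  | inl x, inr y => cross x y
  | inr y, inl x => cross x y
  end.

Lemma sum_dist_extending : extending_metric sum_dist.
Proof.
split=> //; split.
- by case=> x /=; rewrite mdistxx.
- case=> [x|y] [x'|y'] /= xy.
  + by rewrite (mdist_positivity _ _ xy).
  + by move: (cross_ge x y'); rewrite xy leNgt e0.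
  + by move: (cross_ge x' y); rewrite xy leNgt e0.
  + by rewrite (mdist_positivity _ _ xy).
- by case=> [x|y] [x'|y'] //=; exact: metric_sym.
- case=> [x|y] [x'|y'] [x''|y''] /=.
  + exact: metric_triangle.
  + exact: cross_trl.
  + by rewrite addrC metric_sym; exact: cross_trl.
  + exact: cross_triY.
  + exact: cross_triX.
  + exact: cross_trr.
  + by rewrite addrC metric_sym; exact: cross_trr.
  + exact: metric_triangle.
Qed.

Lemma sum_dist_corr x y : C x y -> sum_dist (inl x) (inr y) <= e.
Proof. by move=> Cxy; have := cross_le x y Cxy; rewrite !mdistxx /=; lra. Qed.

Lemma ghp_rep_le : ghp_rep X Y <= 3 * e.
Proof.
have ext := sum_dist_extending; have [md dX dY] := ext.
have ge0 (d : X + Y -> X + Y -> R) : is_metric d -> forall z w, 0 <= d z w.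
  move=> md' z w; have := is_metric_triangle md' w z z.
  by rewrite (is_metric_sym md' w z) (is_metric_xx md'); lra.
have inf_ge0 (S : set R) : (forall r, S r -> 0 < r) -> 0 <= inf S.
  move=> S0; have [->|/set0P Sn0] := eqVneq S set0; first by rewrite inf0.
  by apply: lb_le_inf => // r /S0 /ltW.
have inf_le (S : set R) : (forall r, S r -> 0 < r) -> S e -> inf S <= e.
  by move=> S0 Se; apply: ge_inf => //; exists 0 => r /S0 /ltW.
(* One [e] each for the Prohorov distance, the Hausdorff distance and the roots. *)
apply: (@le_trans _ _ (e + e + e)); last by lra.
apply: (@le_trans _ _ (prohorov sum_dist (fun A => cmms_measure X (inl @^-1` A))
  (fun A => cmms_measure Y (inr @^-1` A))
  + hausdorff_dist sum_dist (range inl) (range inr)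
  + sum_dist (inl point) (inr point))).
  apply: ge_inf; last by exists sum_dist.
  exists 0 => _ [d [md' _ _] <-]; rewrite !addr_ge0 ?ge0//.
  - by apply: inf_ge0 => r [].
  - by apply: inf_ge0 => r [].
apply: lerD; last exact/sum_dist_corr/(corr_root corrC.1).
apply: lerD; apply: inf_le => [r []//|].
- split=> // A cA; have cX := preimage_closed_for dX cA.
  have cY := preimage_closed_for dY cA; split.
  + rewrite (le_trans (corr_mass corrC.1 cX))// leeD2r//.
    apply: cmms_le; first exact: corr_closed corrC.1 _ cX.
      exact: fattening_preimage_closed.
    move=> y [x Ax Cxy]; apply: (@fattening_le _ _ A _ _ (inl x)) => //.
    by rewrite (is_metric_sym md); exact: sum_dist_corr.
  + rewrite (le_trans (corr_mass corrC.2 cY))// leeD2r//.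
    apply: cmms_le; first exact: corr_closed corrC.2 _ cY.
      exact: fattening_preimage_closed.
    by move=> x [y Ay Cxy]; apply: (@fattening_le _ _ A _ _ (inr y)) => //; exact: sum_dist_corr.
- split=> // _ [x _ <-].
  + have [y Cxy] := corr_total corrC.1 x.
    by apply: (@fattening_le _ _ _ _ _ (inr y)); [exists y|exact: sum_dist_corr].
  + have [y Cxy] := corr_total corrC.2 x.
    apply: (@fattening_le _ _ _ _ _ (inl y)); first by exists y.
    by rewrite (is_metric_sym md); exact: sum_dist_corr.
Qed.

End cross_distance.

Lemma approx_ghp_le e X Y : 0 < e -> approx e X Y -> ghp_rep X Y <= 3 * e.
Proof. by move=> e0 [C corrC]; exact: ghp_rep_le corrC. Qed.

(** Two isometric embeddings into an arbitrary [T] allow the roles of [X] and [Y] to be exchanged.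
    The strict bounds make up for infima that are not attained. *)
Lemma ghp_half_corr X Y (T : Type) (d : T -> T -> R) (i : X -> T) (j : Y -> T) (p h e : R) :
  is_metric d ->
  (forall x x', d (i x) (i x') = mdist x x') ->
  (forall y y', d (j y) (j y') = mdist y y') ->
  p < e -> h < e -> d (i point) (j point) < e ->
  (forall x, fattening d (range j) h (i x)) ->
  (forall A, closed_for d A -> (cmms_measure X (i @^-1` A) <=
     cmms_measure Y (j @^-1` fattening d A p) + p%:E)%E) ->
  half_corr e (fun x y => d (i x) (j y) <= e).
Proof.
move=> md di dj pe he re hH hP.
have closed_im A : closed A -> closed (rel_image (fun x y => d (i x) (j y) <= e) A).
  move=> cA; apply/closed_mdistP => y yA.
  apply: (@compact_attains _ _ _ (fun x => d (i x) (j y))).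
  - exact: cmms_closed_compact.
  - move=> x x'; have := is_metric_triangle md (i x') (i x) (j y).
    by rewrite di; lra.
  - move=> f /yA[y' [x Ax xy'] yy']; exists x => //.
    have := is_metric_triangle md (j y') (i x) (j y).
    by rewrite dj metric_sym; lra.
split=> //.
- exact: ltW.
- move=> x; have /fatteningP/(_ _ he)[_ [y _ <-] xy] := hH x.
  by exists y; exact: ltW.
- move=> x x' y y' xy xy'; rewrite -di -dj.
  have := is_metric_triangle md (j y) (i x) (i x').
  have := is_metric_triangle md (j y') (j y) (i x').
  by rewrite (is_metric_sym md (j y') (i x')); lra.
- move=> A cA; pose B := [set z | forall f, 0 < f -> exists2 a, A a & d z (i a) < f].
  have cB : closed_for d B.
    move=> z zB f f0; have f20 : 0 < f / 2 by lra.
    have [w /(_ _ f20)[a Aa wa] zw] := zB _ f20; exists a => //.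
    have := is_metric_triangle md w z (i a); lra.
  have AB : i @^-1` B = A.
    apply/seteqP; split=> [x xB|x Ax f f0]; last first.
      by exists x => //; rewrite (is_metric_xx md).
    move: cA => /closed_mdistP; apply => f /xB[a Aa xa].
    by exists a => //; rewrite -di.
  have := hP _ cB; rewrite AB => /le_trans; apply.
  rewrite leeD ?lee_fin ?(ltW pe)//; apply: cmms_le.
  - exact: fattening_preimage_closed.
  - exact: closed_im.
  move=> y /fatteningP.
  (* The gap between [p] and [e] is split: a point of [B] within [(p + e) / 2], then a point of [A]
     within [(e - p) / 2] of it. *)
  have pe' : p < (p + e) / 2 by lra.
  move=> /(_ _ pe')[z Bz yz]; have [|a Aa za] := Bz ((e - p) / 2); first lra.
  exists a => //; have := is_metric_triangle md z (j y) (i a).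
  by rewrite (is_metric_sym md (j y) (i a)); lra.
Qed.

Lemma ghp_approx e X Y : ghp_rep X Y < e -> approx e X Y.
Proof.
have [f f0 [C corrC]] := approx_ex X Y.
move=> /inf_lt[].
  by eexists; exists (sum_dist C f); first exact: sum_dist_extending.
move=> _ [d [md dX dY] <-] de.
have ge0 z w : 0 <= d z w.
  have := is_metric_triangle md w z z.
  by rewrite (is_metric_sym md w z) (is_metric_xx md); lra.
have [M XM] := compact_diam point (@cmms_compact R X).
have [N YN] := compact_diam point (@cmms_compact R Y).
pose D := d (inl point) (inr point).
have XY x y : d (inl x) (inr y) <= M + D + N.
  have := is_metric_triangle md (inl point) (inl x) (inr y).
  have := is_metric_triangle md (inr point) (inl point) (inr y).
  by rewrite dX dY; have := XM x point; have := YN point y; rewrite /D; lra.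
have MDN : 0 <= M + D + N by rewrite (le_trans _ (XY point point)).
move: de; set P := prohorov _ _ _; set H := hausdorff_dist _ _ _.
rewrite -/D => de.
have mX := fine_ge0 (measure_ge0 (cmms_measure X) setT).
have mY := fine_ge0 (measure_ge0 (cmms_measure Y) setT).
have finX := @cmms_fin _ X setT (measurableT : measurable (setT : set (borel X))).
have finY := @cmms_fin _ Y setT (measurableT : measurable (setT : set (borel Y))).
(* Total masses provide a candidate for the Prohorov distance, diameters one for the Hausdorff
   distance. As all three terms are nonnegative, each is then below [e]. *)
have Pn0 : [set e : R | 0 < e /\ forall A, closed_for d A ->
    (cmms_measure X (inl @^-1` A) <= cmms_measure Y (inr @^-1` fattening d A e) + e%:E)%E /\
    (cmms_measure Y (inr @^-1` A) <= cmms_measure X (inl @^-1` fattening d A e) + e%:E)%E]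
    !=set0.
  exists (1 + fine (cmms_measure X setT) + fine (cmms_measure Y setT)).
  split=> [|A cA]; first by lra.
  split; apply: (le_trans _ (leeDr _ _)) => //.
    rewrite (le_trans (cmms_le (preimage_closed_for dX cA) closedT (@subsetT _ _)))//.
    by rewrite -(fineK finX) lee_fin; lra.
  rewrite (le_trans (cmms_le (preimage_closed_for dY cA) closedT (@subsetT _ _)))//.
  by rewrite -(fineK finY) lee_fin; lra.
have Hn0 : [set e : R | [/\ 0 < e, range inl `<=` fattening d (range inr) e &
    range inr `<=` fattening d (range inl) e]] !=set0.
  exists (1 + (M + D + N)); split=> [|_ [x _ <-]|_ [y _ <-]]; first by lra.
    apply: (@fattening_le _ _ _ _ _ (inr point)); first by exists point.
    by have := XY x point; lra.
  apply: (@fattening_le _ _ _ _ _ (inl point)); first by exists point.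
  by rewrite (is_metric_sym md); have := XY point y; lra.
have P0 : 0 <= P by apply: lb_le_inf => // r [/ltW].
have H0 : 0 <= H by apply: lb_le_inf => // r [/ltW].
have D0 : 0 <= D by exact: ge0.
have [p [p0 pP] pe] := @inf_lt _ _ e Pn0 ltac:(rewrite -/P; lra).
have [h [h0 hX hY] he] := @inf_lt _ _ e Hn0 ltac:(rewrite -/H; lra).
have De : D < e by lra.
exists (fun x y => d (inl x) (inr y) <= e); split.
- apply: (ghp_half_corr md dX dY pe he De) => [x|A /pP[]//].
  by apply: hX; exists x.
- have -> : (fun (y : Y) (x : X) => is_true (d (inl x) (inr y) <= e)) =
      (fun y x => is_true (d (inr y) (inl x) <= e)).
    by apply/funext => y; apply/funext => x; rewrite (is_metric_sym md).
  apply: (ghp_half_corr md dY dX pe he) => [|y|A /pP[]//].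
  + by rewrite (is_metric_sym md).
  + by apply: hY; exists y.
Qed.

End ghp_approx.

(** * Indiscernible spaces *)

Section thickening.
Context {R : realType}.
Implicit Types X Y : cmms R.

Definition thick X (A : set X) (e : R) : set X :=
  [set y | exists2 a, A a & mdist a y <= e].

Lemma thick_closed X (A : set X) e : closed A -> closed (thick A e).
Proof.
move=> cA; apply/closed_mdistP => y yA.
apply: (@compact_attains _ _ _ (fun x => mdist x y)).
- exact: cmms_closed_compact.
- by move=> x x'; have := metric_triangle x x' y; lra.
- move=> f /yA[y' [x Ax xy'] yy']; exists x => //.
  by have := metric_triangle x y' y; rewrite (metric_sym y' y); lra.
Qed.

Lemma thick_sub X (A : set X) e : 0 <= e -> A `<=` thick A e.
Proof. by move=> e0 a Aa; exists a => //; rewrite mdistxx. Qed.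

Lemma thick_le X (A : set X) e f : e <= f -> thick A e `<=` thick A f.
Proof. by move=> ef y [a Aa ay]; exists a => //; exact: le_trans ef. Qed.

Lemma thick_bigcap X (A : set X) : closed A ->
  \bigcap_n thick A n.+1%:R^-1 = A.
Proof.
move=> cA; apply/seteqP; split=> [x xA|x Ax n _]; last first.
  by apply: thick_sub Ax; rewrite invr_ge0.
move: cA => /closed_mdistP; apply => e e0.
have [n _ /(_ n (leqnn n)) /= ne] := near_infty_natSinv_lt (PosNum e0).
have [a Aa ax] := xA n I; exists a => //.
by rewrite metric_sym (le_lt_trans ax).
Qed.

(* Outer regularity along closed neighbourhoods, by continuity from above. *)
Lemma cmms_thick X (A : set X) (e : R) : closed A -> 0 < e ->
  exists2 d, 0 < d & (cmms_measure X (thick A d) <= cmms_measure X A + e%:E)%E.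
Proof.
move=> cA e0; pose F n : set (borel X) := thick A n.+1%:R^-1.
have mF n : measurable (F n) by apply: (measurable_closed X); exact: thick_closed.
have FA : \bigcap_n F n = A by exact: thick_bigcap.
have mA : measurable (A : set (borel X)) by exact: (measurable_closed X).
have : cmms_measure X (F n) @[n --> \oo] --> cmms_measure X (\bigcap_n F n).
  apply: nonincreasing_cvg_mu => //.
  - by rewrite ltey_eq cmms_fin.
  - by rewrite FA.
  - move=> n m nm; apply/subsetPset/thick_le.
    by rewrite lef_pV2 ?posrE// ler_nat.
rewrite FA -(fineK (cmms_fin mA)) => /fine_cvgP[_].
move=> /cvgrPdist_lt/(_ _ e0)[n _ /(_ n (leqnn n)) /=].
rewrite ltr_norml => /andP[+ _] => H.
exists n.+1%:R^-1; first by rewrite invr_gt0.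
rewrite -[leLHS](fineK (cmms_fin (mF n))) -EFinD lee_fin.
move: H; rewrite /F; lra.
Qed.

End thickening.

(* [pushforward] is a measure only under a proof of measurability, which
   canonical structure inference cannot supply. *)
Lemma pushforward_measure_ex {d d'} {T : measurableType d} {T' : measurableType d'}
    {R : realType} (m : {measure set T -> \bar R}) (f : T -> T') :
  measurable_fun setT f ->
  exists m' : {measure set T' -> \bar R}, forall A, m' A = m (f @^-1` A).
Proof. by move=> mf; unshelve eexists (pushforward m f). Qed.

Lemma borel_eq_closed {R : realType} (X : cmms R)
    (m1 m2 : {measure set (borel X) -> \bar R}) :
  (m1 setT < +oo)%E ->
  (forall A : set X, closed A -> m1 A = m2 A) ->
  forall A : set (borel X), measurable A -> m1 A = m2 A.
Proof.
move=> fin m12 A mA.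
apply: (@g_sigma_algebra_measure_unique _ _ (borel X) (@closed X) _ (fun=> setT)) => //.
- by move=> B; exact: (measurable_closed X).
- by rewrite bigcup_const.
- exact: closedI.
- move: A mA; apply: smallest_sub; first exact: smallest_sigma_algebra.
  move=> U oU; rewrite -(setCK U); apply: sigma_algebraC.
  by apply: sub_sigma_algebra; exact: open_closedC.
Qed.

Section indiscernible.
Context {R : realType}.
Implicit Types X Y : cmms R.

(** By compactness the image ultrafilter has a cluster point, and an ultrafilter converges to each
    of its cluster points. *)
Lemma ultra_lim X (U : set_system nat) (u : nat -> X) : UltraFilter U ->
  exists x, forall e : R, 0 < e -> U [set n | mdist x (u n) < e].
Proof.
move=> UU; have UP : ProperFilter U := @ultra_proper _ _ UU.
have := @cmms_compact R X (u @ U) _ filterT; case=> x [_ xu].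
exists x => e e0.
have [//|Un] := in_ultra_setVsetC [set n | mdist x (u n) < e] UU.
have [y [/= ny xy]] := xu (~` [set y | mdist x y < e]) _ Un (nbhs_mdist x e0).
by [].
Qed.

(** A single ultrafilter makes the selections converge at all points at once, without a diagonal
    extraction over a dense set. *)
Lemma approx_indiscernible X Y :
  (forall e, 0 < e -> approx e X Y) -> strong_equiv X Y.
Proof.
move=> XY.
have [eps eps0 eps_cvg] : exists2 eps : nat -> R, (forall n, 0 < eps n) &
    forall e, 0 < e -> \forall n \near \oo, eps n < e.
  exists (fun n => n.+1%:R^-1) => [n|e e0]; first by rewrite invr_gt0.
  exact: (near_infty_natSinv_lt (PosNum e0)).
have /choice[C corrC] n : exists C : X -> Y -> Prop, correspondence (eps n) C.
  exact: XY.
have /choice[f Cf] n : exists f : X -> Y, forall x, C n x (f x).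
  by have [h Ch] := boolp.choice (corr_total (corrC n).1); exists h.
have /choice[g Cg] n : exists g : Y -> X, forall y, C n (g y) y.
  by have [h Ch] := boolp.choice (corr_total (corrC n).2); exists h.
have [U [UU Uoo]] := @ultraFilterLemma nat \oo _.
have UP : ProperFilter U := @ultra_proper _ _ UU.
have Usmall e : 0 < e -> U [set n | eps n < e].
  by move=> e0; apply: Uoo; exact: eps_cvg.
have CXY n x x' y y' : C n x y -> C n x' y' ->
    mdist x x' <= mdist y y' + 2 * eps n /\
    mdist y y' <= mdist x x' + 2 * eps n.
  by move=> c c'; split; [exact: (corr_dist (corrC n).1 c c')|exact: (corr_dist (corrC n).2 c c')].
have /choice[phi phiE] x := ultra_lim (fun n => f n x) UU.
have phi_iso x x' : mdist (phi x) (phi x') = mdist x x'.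
  apply/eqP; rewrite eq_le; apply/andP; split; apply/ler_addgt0Pr => e e0;
    have e40 : 0 < e / 4 by lra.
  - have [n [[/= n1 n2] n3]] :=
      filter_ex (filterI (filterI (phiE x _ e40) (phiE x' _ e40)) (Usmall _ e40)).
    have := metric_triangle (phi x) (f n x) (phi x').
    have := metric_triangle (f n x) (f n x') (phi x').
    have [_] := CXY _ _ _ _ _ (Cf n x) (Cf n x').
    by rewrite (metric_sym (f n x') (phi x')); move: n1 n2 n3 => /=; lra.
  - have [n [[/= n1 n2] n3]] :=
      filter_ex (filterI (filterI (phiE x _ e40) (phiE x' _ e40)) (Usmall _ e40)).
    have := metric_triangle (f n x) (phi x) (f n x').
    have := metric_triangle (phi x) (phi x') (f n x').
    have [+ _] := CXY _ _ _ _ _ (Cf n x) (Cf n x').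
    by rewrite (metric_sym (f n x) (phi x)); move: n1 n2 n3 => /=; lra.
(* The selections f n converge uniformly along U: a sequence of violations would
   have limits x and y with y both equal to and far from phi x. *)
have unif e : 0 < e ->
    U [set n | forall x y, C n x y -> mdist (phi x) y < e].
  move=> e0; have [//|Un] := in_ultra_setVsetC
    [set n | forall x y, C n x y -> mdist (phi x) y < e] UU.
  have e80 : 0 < e / 8 by lra.
  have /choice[v vE] n : exists v : X * Y,
      (~ (forall x y, C n x y -> mdist (phi x) y < e)) ->
      C n v.1 v.2 /\ e <= mdist (phi v.1) v.2.
    have [?|] := pselect (forall x y, C n x y -> mdist (phi x) y < e).
      by exists (point, point).
    move=> /existsNP[x /existsNP[y /not_implyP[Cxy /negP]]].
    by rewrite -leNgt => xy; exists (x, y).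
  have [x xE] := ultra_lim (fun n => (v n).1) UU.
  have [y yE] := ultra_lim (fun n => (v n).2) UU.
  have [n [[/= /vE[Cn ev] n1] [n2 n3]]] := filter_ex (filterI (filterI Un
    (phiE x _ e80)) (filterI (xE _ e80) (Usmall _ e80))).
  have [_] := CXY _ _ _ _ _ (Cf n x) Cn.
  have := metric_triangle (phi (v n).1) (phi x) (v n).2.
  have := metric_triangle (phi x) (f n x) (v n).2.
  rewrite phi_iso (metric_sym (v n).1); move: n1 n2 n3 => /=; lra.
have phi_surj y : exists x, phi x = y.
  have [x xE] := ultra_lim (fun n => g n y) UU.
  exists x; apply/mdist_positivity/eqP; rewrite eq_le mdist_ge0 andbT.
  apply/ler_addgt0Pr => e e0; have e40 : 0 < e / 4 by lra.
  have [n [/= n1 n2]] := filter_ex (filterI (xE _ e40) (unif _ e40)).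
  have := metric_triangle (phi x) (phi (g n y)) y.
  by rewrite phi_iso; have := n2 _ _ (Cg n y); lra.
have phi_pt : phi point = point.
  apply/mdist_positivity/eqP; rewrite eq_le mdist_ge0 andbT.
  apply/ler_addgt0Pr => e e0.
  have [n /(_ _ _ (corr_root (corrC n).1))] := filter_ex (unif _ e0); lra.
have im_closed A : closed A -> closed (phi @` A) by exact: isometry_image_closed.
have pre_closed A : closed A -> closed (phi @^-1` A).
  move=> cA; apply: preimage_closed cA => x _; exact: isometry_continuous.
(* For [U]-many [n] the relation maps [A] into a thin neighbourhood of its image under [phi], whose
   mass is bounded by outer regularity. *)
have phi_le A : closed A -> (cmms_measure X A <= cmms_measure Y (phi @` A))%E.
  move=> cA; apply/lee_addgt0Pr => e e0; have e20 : 0 < e / 2 by lra.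
  have [d d0 Ad] := cmms_thick (im_closed _ cA) e20.
  have [n [/= n1 n2]] := filter_ex (filterI (unif _ d0) (Usmall _ e20)).
  rewrite (le_trans (corr_mass (corrC n).1 cA))// (splitr e) EFinD addeA.
  rewrite leeD ?lee_fin ?(ltW n2)// (le_trans _ Ad)//; apply: cmms_le.
  - exact: (corr_closed (corrC n).1 cA).
  - exact/thick_closed/im_closed.
  - by move=> y [x Ax Cxy]; exists (phi x); [exists x|exact/ltW/n1].
have phi_ge A : closed A -> (cmms_measure Y A <= cmms_measure X (phi @^-1` A))%E.
  move=> cA; apply/lee_addgt0Pr => e e0; have e20 : 0 < e / 2 by lra.
  have [d d0 Ad] := cmms_thick (pre_closed _ cA) e20.
  have [n [/= n1 n2]] := filter_ex (filterI (unif _ d0) (Usmall _ e20)).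
  rewrite (le_trans (corr_mass (corrC n).2 cA))// (splitr e) EFinD addeA.
  rewrite leeD ?lee_fin ?(ltW n2)// (le_trans _ Ad)//; apply: cmms_le.
  - exact: (corr_closed (corrC n).2 cA).
  - by apply: thick_closed; exact: pre_closed.
  - move=> x [y Ay Cxy]; have [x' x'y] := phi_surj y.
    exists x'; first by rewrite /= x'y.
    by rewrite -phi_iso x'y metric_sym; exact/ltW/n1.
exists phi; split => // A mA.
have mphi : measurable_fun [set: borel X] (phi : borel X -> borel Y).
  by move=> _ B mB; rewrite setTI; exact: isometry_preimage_borel.
have [m' m'E] := pushforward_measure_ex (cmms_measure X) mphi.
rewrite -m'E; apply: (@borel_eq_closed R Y) => //.
- by rewrite m'E; change (cmms_measure X setT < +oo)%E; rewrite ltey_eq cmms_fin.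
- move=> B cB; rewrite m'E; apply/eqP; rewrite eq_le phi_ge// andbT.
  rewrite (le_trans (phi_le _ (pre_closed _ cB)))//.
  apply: cmms_le => //; first by apply: im_closed; exact: pre_closed.
  by move=> y [x Bx <-].
Qed.

End indiscernible.

(** * Limits of Cauchy sequences *)

Section content_extension.
Context {R : realType} (T : pmetricType R) (lam : set T -> R).
Hypothesis Tcompact : compact [set: T].
Hypothesis lam0 : lam set0 = 0.
Hypothesis lam_le : forall K L, closed K -> closed L -> K `<=` L -> lam K <= lam L.
Hypothesis lamU_le : forall K L, closed K -> closed L ->
  lam (K `|` L) <= lam K + lam L.
Hypothesis lamU_ge : forall K L, closed K -> closed L -> K `&` L = set0 ->
  lam K + lam L <= lam (K `|` L).
Hypothesis lam_regular : forall K e, closed K -> 0 < e ->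
  exists U, [/\ open U, K `<=` U &
    forall L, closed L -> L `<=` U -> lam L <= lam K + e].

(** Halmos's route from a content on compact sets to a Borel measure: an inner content on open sets,
    the outer measure it induces, then Caratheodory. In the compact space [T] the closed sets are
    the compact ones. *)
Definition inner_content (U : set T) : \bar R :=
  ereal_sup [set (lam K)%:E | K in [set K | closed K /\ K `<=` U]].

Definition outer_content (A : set T) : \bar R :=
  ereal_inf [set inner_content U | U in [set U | open U /\ A `<=` U]].

Let lam_inner K U : closed K -> K `<=` U -> ((lam K)%:E <= inner_content U)%E.
Proof. by move=> cK KU; apply: ereal_sup_ubound; exists K. Qed.

Let inner_leP U (x : \bar R) :
  (forall K, closed K -> K `<=` U -> ((lam K)%:E <= x)%E) -> (inner_content U <= x)%E.
Proof. by move=> Ux; apply: ge_ereal_sup => _ [K [cK KU] <-]; exact: Ux. Qed.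

Let inner_ge0 U : (0 <= inner_content U)%E.
Proof. by have := lam_inner closed0 (@sub0set _ U); rewrite lam0. Qed.

Let inner_le U V : U `<=` V -> (inner_content U <= inner_content V)%E.
Proof.
by move=> UV; apply: inner_leP => K cK KU; apply: lam_inner => //; exact: subset_trans UV.
Qed.

Let inner_fin U : inner_content U \is a fin_num.
Proof.
rewrite ge0_fin_numE//; apply: (@le_lt_trans _ _ (lam setT)%:E); last exact: ltry.
by apply: inner_leP => K cK _; rewrite lee_fin; apply: lam_le => //; exact: closedT.
Qed.

(** The parts of [K] outside [V] and outside [U] are disjoint and closed. Removing neighbourhoods
    that separate them cuts [K] into two closed pieces, one inside [U] and one inside [V]. *)
Let innerU U V : open U -> open V ->
  (inner_content (U `|` V) <= inner_content U + inner_content V)%E.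
Proof.
move=> oU oV; apply: inner_leP => K cK KUV.
have cKV : closed (K `\` V) by apply: closedI => //; exact: open_closedC.
have cKU : closed (K `\` U) by apply: closedI => //; exact: open_closedC.
have KVU0 : (K `\` V) `&` (K `\` U) = set0.
  by apply/seteqP; split=> // x [[/KUV[Ux|Vx] nV] [_ nU]].
have /(@normal_openP R)/(_ _ _ cKV cKU KVU0)[U' [V' [oU' oV' AU' BV' UV']]] :=
  @pseudometric_normal R T.
have cK1 : closed (K `\` V') by apply: closedI => //; exact: open_closedC.
have cK2 : closed (K `\` U') by apply: closedI => //; exact: open_closedC.
have KE : K = (K `\` V') `|` (K `\` U').
  apply/seteqP; split=> [x Kx|x [[]|[]]//].
  have [V'x|?] := pselect (V' x); last by left.
  right; split=> // U'x; suff : (U' `&` V') x by rewrite UV'.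
  by [].
rewrite {}KE; apply: (@le_trans _ _ ((lam (K `\` V'))%:E + (lam (K `\` U'))%:E)%E).
  by rewrite -EFinD lee_fin; exact: lamU_le.
apply: leeD; apply: lam_inner => // x [Kx nx].
- by apply: contrapT => nU; exact/nx/BV'.
- by apply: contrapT => nV; exact/nx/AU'.
Qed.

Let inner_bigcup (U : nat -> set T) : (forall n, open (U n)) ->
  (inner_content (\bigcup_n U n) <= \sum_(0 <= n <oo) inner_content (U n))%E.
Proof.
move=> oU; apply: inner_leP => K cK KU.
have KN : exists N, K `<=` \big[setU/set0]_(n < N) U n.
  have cptK : compact K by exact: subclosed_compact Tcompact _.
  have /compact_near_coveringP/(_ _ \oo
    (fun N x => (\big[setU/set0]_(n < N) U n) x) _) := cptK.
  case=> [x /KU[k _ Ukx]|N _ /(_ N (leqnn N)) ?]; last by exists N.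
  exists (U k, [set n | (k < n)%N]) => /=.
    by split; [exact: open_nbhs_nbhs|exists k.+1].
  move=> [y n] /= [Uky kn].
  by rewrite -bigcup_mkord; exists k.
have [N KN'] := KN.
apply: (@le_trans _ _ (\sum_(0 <= n < N) inner_content (U n))%E); last first.
  by apply: nneseries_lim_ge => n _ _.
apply: (@le_trans _ _ (inner_content (\big[setU/set0]_(n < N) U n))).
  exact: lam_inner.
elim: (N) => [|n ih].
  rewrite big_ord0 big_geq//; apply: inner_leP => L cL; rewrite subset0 => ->.
  by rewrite lam0.
rewrite big_ord_recr big_nat_recr//=; apply: le_trans (innerU _ _) _ => //.
  by rewrite -bigcup_mkord; apply: bigcup_open.
by rewrite leeD2r.
Qed.

Let outer_le A U : open U -> A `<=` U -> (outer_content A <= inner_content U)%E.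
Proof. by move=> oU AU; apply: ereal_inf_lbound; exists U. Qed.

Let outer_geP A (x : \bar R) :
  (forall U, open U -> A `<=` U -> (x <= inner_content U)%E) -> (x <= outer_content A)%E.
Proof. by move=> Ax; apply: le_ereal_inf_tmp => _ [U [oU AU] <-]; exact: Ax. Qed.

Let outer_ge0 A : (0 <= outer_content A)%E.
Proof. exact: outer_geP. Qed.

Let outer_mono A B : A `<=` B -> (outer_content A <= outer_content B)%E.
Proof.
by move=> AB; apply: outer_geP => U oU BU; apply: outer_le => //; exact: subset_trans BU.
Qed.

Let outer_open U : open U -> outer_content U = inner_content U.
Proof.
move=> oU; apply/eqP; rewrite eq_le outer_le//=.
by apply: outer_geP => V oV; exact: inner_le.
Qed.

Let outer0 : outer_content set0 = 0%E.
Proof.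
apply/eqP; rewrite eq_le outer_ge0 andbT outer_open; last exact: open0.
by apply: inner_leP => L cL; rewrite subset0 => ->; rewrite lam0.
Qed.

Let outer_fin A : outer_content A \is a fin_num.
Proof.
rewrite ge0_fin_numE//; apply: (@le_lt_trans _ _ (inner_content setT)).
  by apply: outer_le => //; exact: openT.
by rewrite ltey_eq inner_fin.
Qed.

Let outer_sigma_subadditive : sigma_subadditive outer_content.
Proof.
move=> F; apply/lee_addgt0Pr => e e0.
have /choice[U UE] n : exists U, [/\ open U, F n `<=` U &
    (inner_content U <= outer_content (F n) + (e / (2 ^ n.+1)%:R)%:E)%E].
  have en : 0 < e / (2 ^ n.+1)%:R by rewrite divr_gt0// ltr0n expn_gt0.
  have [_ [V [oV FV] <-] VF] := lb_ereal_inf_adherent en (outer_fin (F n)).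
  by exists V; split=> //; exact: ltW.
apply: (@le_trans _ _ (inner_content (\bigcup_n U n))).
  apply: outer_le; first by apply: bigcup_open => n _; have [] := UE n.
  by apply: subset_bigcup => n _; have [] := UE n.
apply: le_trans (inner_bigcup _) _; first by move=> n; have [] := UE n.
apply: (@le_trans _ _
  (\sum_(0 <= n <oo) (outer_content (F n) + (e / (2 ^ n.+1)%:R)%:E))%E).
  by apply: lee_nneseries => // n _; have [] := UE n.
by apply: epsilon_trick => //; exact: ltW.
Qed.

HB.instance Definition _ := isOuterMeasure.Build R T outer_content
  outer0 outer_ge0 outer_mono outer_sigma_subadditive.

Let outer_closed K : closed K -> outer_content K = (lam K)%:E.
Proof.
move=> cK; apply/eqP; rewrite eq_le; apply/andP; split.
  apply/lee_addgt0Pr => e e0; have [U [oU KU UL]] := lam_regular cK e0.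
  apply: le_trans (outer_le oU KU) _; apply: inner_leP => L cL LU.
  by rewrite -EFinD lee_fin; exact: UL.
by apply: outer_geP => U oU KU; exact: lam_inner.
Qed.

(** Inside an open [V] containing [A], a closed [K] nearly exhausts the part in [U] and a closed [L]
    nearly exhausts what remains of [V] outside [K]. These are disjoint, so [lamU_ge] applies.
    Finiteness of all values allows terms to change sides. *)
Let open_caratheodory U : open U -> outer_content.-caratheodory U.
Proof.
move=> oU; apply: le_caratheodory_measurable => A.
apply: outer_geP => V oV AV; apply: (@le_trans _ _
    (inner_content (V `&` U) + outer_content (V `&` ~` U))%E).
  apply: leeD; last by apply: outer_mono => x [/AV].
  by apply: outer_le; [exact: openI|move=> x [/AV]].
rewrite -leeBrDr//; apply: inner_leP => K cK KVU.
rewrite leeBrDr//.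
have oVK : open (V `\` K) by apply: openI => //; exact: closed_openC.
apply: (@le_trans _ _ ((lam K)%:E + inner_content (V `\` K))%E).
  rewrite leeD2l//; apply: outer_le => // x [Vx nUx].
  by split=> // Kx; apply: nUx; have [] := KVU _ Kx.
rewrite addeC -leeBrDr//; apply: inner_leP => L cL LVK.
rewrite leeBrDr// addeC -EFinD.
apply: (@le_trans _ _ (lam (K `|` L))%:E).
  rewrite lee_fin; apply: lamU_ge => //.
  by apply/seteqP; split=> // x [Kx /LVK[]].
apply: lam_inner; first exact: closedU.
by move=> x [/KVU[]|/LVK[]].
Qed.

Let borel_caratheodory (A : set (borel T)) :
  measurable A -> outer_content.-caratheodory A.
Proof.
move: A; apply: smallest_sub; last exact: open_caratheodory.
split.
- exact: caratheodory_measurable_set0.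
- by move=> A mA; rewrite setTD; exact: caratheodory_measurable_setC.
- exact: caratheodory_measurable_bigcup.
Qed.

(** [outer_content] carries the outer measure structure; this copy is typed over the Borel
    sigma-algebra to carry the measure structure. *)
Definition content_measure : set (borel T) -> \bar R := outer_content.

Let content_measure0 : content_measure set0 = 0%E. Proof. exact: outer0. Qed.

Let content_measure_ge0 A : (0 <= content_measure A)%E. Proof. exact: outer_ge0. Qed.

Let content_sigma_additive : semi_sigma_additive content_measure.
Proof.
move=> F mF tF mUF.
apply: (@caratheodory_measure_sigma_additive R T outer_content) => //.
- by move=> i; exact: borel_caratheodory.
- exact: borel_caratheodory.
Qed.

HB.instance Definition _ := isMeasure.Build _ (borel T) R content_measure
  content_measure0 content_measure_ge0 content_sigma_additive.

Let content_fin : fin_num_fun content_measure.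
Proof. by move=> A _; exact: outer_fin. Qed.

HB.instance Definition _ := Measure_isFinite.Build _ (borel T) R content_measure
  content_fin.

Lemma content_extension : exists mu : {finite_measure set (borel T) -> \bar R},
  forall K : set T, closed K -> mu K = (lam K)%:E.
Proof. by exists content_measure; exact: outer_closed. Qed.

End content_extension.

(* Neither [generic_quotient] nor [set] can be used here: [Xc] forces their
   universes above that of [pmetricType]. *)
Definition metric_classes (R : realType) (T : Type) (p : T -> T -> R) :=
  {A : T -> Prop | exists x, A = (fun y => p x y = 0)}.

HB.instance Definition _ (R : realType) (T : Type) (p : T -> T -> R) :=
  gen_eqMixin (metric_classes p).
HB.instance Definition _ (R : realType) (T : Type) (p : T -> T -> R) :=
  gen_choiceMixin (metric_classes p).

Section metric_quotient.
Context {R : realType} (T : Type) (p : T -> T -> R).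
Hypothesis pxx : forall x, p x x = 0.
Hypothesis psym : forall x y, p x y = p y x.
Hypothesis ptriangle : forall y x z, p x z <= p x y + p y z.

Local Notation Q := (metric_classes p).

Let q x : Q := exist _ _ (ex_intro _ x erefl).

Let rep (A : Q) : T := sval (cid (svalP A)).

Let repK A : q (rep A) = A.
Proof.
rewrite /rep; case: cid => x /= Ax; case: A Ax => A h /= Ax.
exact: eq_exist (esym Ax).
Qed.

Let pge0 x y : 0 <= p x y.
Proof. by have := ptriangle y x x; rewrite pxx (psym y x); lra. Qed.

Let q_eq x y : q x = q y <-> p x y = 0.
Proof.
split=> [[xy]|xy]; first by have := pxx y; rewrite -[p y y = 0]/((fun z => p y z = 0) y) -xy.
apply: eq_exist; apply/funext => z; apply/propext; split=> h; apply/eqP;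
  rewrite eq_le pge0 andbT.
  by rewrite (le_trans (ptriangle x y z))// h (psym y) xy addr0.
by rewrite (le_trans (ptriangle y x z))// h xy addr0.
Qed.

Let p_rep x : p (rep (q x)) x = 0.
Proof. by apply/q_eq; rewrite repK. Qed.

Let qdist (A B : Q) : R := p (rep A) (rep B).

Let qdistE x y : qdist (q x) (q y) = p x y.
Proof.
have px := p_rep x; have py := p_rep y; rewrite /qdist.
set a := rep _ in px *; set b := rep _ in py *.
apply/eqP; rewrite eq_le; apply/andP; split.
  have := ptriangle x a b; have := ptriangle y x b; rewrite (psym y b); lra.
have := ptriangle a x y; have := ptriangle b a y; rewrite (psym x a); lra.
Qed.

Let qdistxx x : qdist x x = 0. Proof. exact: pxx. Qed.

Let qdist_pos x y : qdist x y = 0 -> x = y.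
Proof. by move=> /q_eq; rewrite !repK. Qed.

Let qdist_sym x y : qdist x y = qdist y x. Proof. exact: psym. Qed.

Let qdist_triangle y x z : qdist x z <= qdist x y + qdist y z.
Proof. exact: ptriangle. Qed.

Lemma metric_quotient (t : T) : exists (M : pmetricType R) (f : T -> M),
  [/\ forall y, exists x, f x = y, forall x y, mdist (f x) (f y) = p x y &
      f t = point].
Proof.
pose M : pmetricType R := HB.pack Q
  (isMetric.Build R Q qdistxx qdist_pos qdist_sym qdist_triangle)
  (isPointed.Build Q (q t)).
by exists M, q; split=> // y; exists (rep y); rewrite repK.
Qed.

End metric_quotient.

(** * Threads through a sequence of correspondences *)

Section threads.
Context {R : realType} (X : nat -> cmms R) (r : nat -> R).
Context (C : forall n, X n -> X n.+1 -> Prop).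
Hypothesis corrC : forall n, correspondence (r n - r n.+1) (@C n).
Hypothesis r_ge0 : forall n, 0 <= r n.
Hypothesis r_cvg : forall e, 0 < e -> exists n, r n < e.

(** [r n] is the total size of the correspondences from [n] on; writing each size as [r n - r n.+1]
    makes the estimates telescope. *)
Definition thread (t : forall n, X n) := forall n, C (t n) (t n.+1).

Definition root_thread : forall n, X n := fun n => point.

Lemma root_threadP : thread root_thread.
Proof. by move=> n; exact: corr_root (corrC n).1. Qed.

Lemma thread_splice (u t : forall n, X n) n : thread u -> thread t ->
  C (u n) (t n.+1) ->
  exists s, [/\ thread s, forall m, (m <= n)%N -> s m = u m &
                forall m, (n < m)%N -> s m = t m].
Proof.
move=> tu tt Cut; exists (fun m => if (m <= n)%N then u m else t m); split.
- move=> m /=; have [mn|mn|->] := ltngtP m n.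
  + exact: tu.
  + exact: tt.
  + exact: Cut.
- by move=> m ->.
- by move=> m; rewrite ltnNge => /negbTE ->.
Qed.

Lemma thread_backward n (x : X n) (t : forall m, X m) :
  (forall m, (n < m)%N -> C (t m) (t m.+1)) -> C x (t n.+1) ->
  exists s, [/\ thread s, s n = x & forall m, (n < m)%N -> s m = t m].
Proof.
elim: n x t => [|n ih] x t tt Cxt.
  exists (dfwith t 0%N x); split.
  - case=> [|m]; first by rewrite dfwithin dfwithout.
    by rewrite !dfwithout//; exact: tt.
  - exact: dfwithin.
  - by case=> // m _; rewrite dfwithout.
have [y Cyx] := corr_total (corrC n).2 x.
have [||s [ts sn st]] := ih y (dfwith t n.+1 x).
- move=> m; rewrite leq_eqVlt => /predU1P[<-|nm].
    by rewrite dfwithin dfwithout// neq_ltn ltnSn.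
  rewrite !dfwithout; first exact: tt.
    by rewrite neq_ltn ltnS (ltnW nm).
  by rewrite neq_ltn nm.
- by rewrite dfwithin.
exists s; split=> [//||m nm]; first by rewrite st// dfwithin.
by rewrite st ?(ltnW nm)// dfwithout// neq_ltn nm.
Qed.

Lemma thread_through n (x : X n) : exists2 s, thread s & s n = x.
Proof.
pose f m (y : X m) : X m.+1 := sval (cid (corr_total (corrC m).1 y)).
have Cf m (y : X m) : C y (f m y) := svalP (cid (corr_total (corrC m).1 y)).
(* A dependent recursion has to start at 0, so [F] takes the coordinates of [b] up to [n], where it
   is [x], and follows the relations only from there. [thread_backward] then repairs the coordinates
   below [n]. *)
pose b := dfwith root_thread n x.
pose F := nat_rect (fun m => X m) (b 0%N)
  (fun m y => if (m.+1 <= n)%N then b m.+1 else f m y).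
have Fn : F n = x.
  rewrite -[RHS](@dfwithin _ _ root_thread n x) -/b.
  have Fb k : (k <= n)%N -> F k = b k by case: k => //= k ->.
  exact: Fb.
have CF m : (n <= m)%N -> C (F m) (F m.+1).
  by move=> nm; rewrite /= ltnNge nm; exact: Cf.
have CxF : C x (F n.+1) by have := CF _ (leqnn n); rewrite Fn.
have [s [ts sn _]] := thread_backward (fun m nm => CF m (ltnW nm)) CxF.
by exists s.
Qed.

Lemma thread_dist s t n m : thread s -> thread t -> (n <= m)%N ->
  `|mdist (s n) (t n) - mdist (s m) (t m)| <= 2 * (r n - r m).
Proof.
move=> ts tt; elim: m => [|m ih].
  by rewrite leqn0 => /eqP ->; rewrite !subrr normr0 mulr0.
rewrite leq_eqVlt => /predU1P[->|/ih].
  by rewrite !subrr normr0 mulr0.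
have := corr_dist (corrC m).1 (ts m) (tt m).
have := corr_dist (corrC m).2 (ts m) (tt m).
rewrite !ler_norml => h1 h2 /andP[h3 h4]; apply/andP; split; lra.
Qed.

(** By [thread_dist] these numbers do not increase with [n] along threads, so the infimum is the
    limit of the coordinate distances. *)
Definition thread_pdist (s t : forall n, X n) : R :=
  inf [set mdist (s n) (t n) + 2 * r n | n in setT].

Lemma thread_pdist_le s t n : thread s -> thread t ->
  `|thread_pdist s t - mdist (s n) (t n)| <= 2 * r n.
Proof.
move=> ts tt; have lb k : lbound [set mdist (s n) (t n) + 2 * r n | n in setT]
    (mdist (s k) (t k) - 2 * r k).
  move=> _ [m _ <-]; have rk := r_ge0 k; have rm := r_ge0 m.
  have [/(thread_dist ts tt)|/ltnW/(thread_dist ts tt)] := leqP k m;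
    rewrite ler_norml => /andP[]; lra.
have ge : mdist (s n) (t n) - 2 * r n <= thread_pdist s t.
  by apply: lb_le_inf (lb n); exists (mdist (s 0%N) (t 0%N) + 2 * r 0%N), 0%N.
have le : thread_pdist s t <= mdist (s n) (t n) + 2 * r n.
  by apply: ge_inf; [exists (mdist (s n) (t n) - 2 * r n)|exists n].
rewrite ler_norml; apply/andP; split; lra.
Qed.

Let thread_pdist_eq s t (a : R) : thread s -> thread t ->
  (forall e, 0 < e -> exists n, `|mdist (s n) (t n) - a| <= e /\ r n < e) ->
  thread_pdist s t = a.
Proof.
move=> ts tt h; apply/eqP; rewrite eq_le; apply/andP; split;
  apply/ler_addgt0Pr => e e0; have [|n []] := h (e / 4); [lra| |lra|];
  have := thread_pdist_le n ts tt; rewrite !ler_norml;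
  move=> /andP[? ?] /andP[? ?] ?; lra.
Qed.

Lemma thread_pdist_xx s : thread s -> thread_pdist s s = 0.
Proof.
move=> ts; apply: thread_pdist_eq => // e /[dup] e0 /r_cvg[n rn]; exists n.
by rewrite mdistxx subrr normr0 ltW.
Qed.

Lemma thread_pdist_sym s t : thread_pdist s t = thread_pdist t s.
Proof.
by congr inf; apply/seteqP; split=> _ [n _ <-]; exists n => //; rewrite metric_sym.
Qed.

Lemma thread_pdist_triangle t s u : thread s -> thread t -> thread u ->
  thread_pdist s u <= thread_pdist s t + thread_pdist t u.
Proof.
move=> ts tt tu; apply/ler_addgt0Pr => e e0.
have [|n rn] := r_cvg (e := e / 6); first lra.
have := metric_triangle (s n) (t n) (u n).
have := thread_pdist_le n ts tt; have := thread_pdist_le n ts tu.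
have := thread_pdist_le n tt tu; rewrite !ler_norml.
move=> /andP[? ?] /andP[? ?] /andP[? ?]; lra.
Qed.


End threads.

(** * Compactness of the space of threads *)

Section thread_space.
Context {R : realType} (X : nat -> cmms R) (r : nat -> R).
Context (C : forall n, X n -> X n.+1 -> Prop).
Hypothesis corrC : forall n, correspondence (r n - r n.+1) (@C n).
Hypothesis r_ge0 : forall n, 0 <= r n.
Hypothesis r_cvg : forall e, 0 < e -> exists n, r n < e.

Lemma thread_quotient : exists (M : pmetricType R) (q : (forall n, X n) -> M),
  [/\ forall y, exists2 t, thread C t & q t = y,
      forall s t, thread C s -> thread C t ->
        mdist (q s) (q t) = thread_pdist r s t &
      q (root_thread X) = point].
Proof.
(* The pseudometric axioms hold for threads; sending every other sequence to the root thread extends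
   them to the whole product. *)
pose rho (t : forall n, X n) := if pselect (thread C t) then t else root_thread X.
have rhoP t : thread C (rho t).
  rewrite /rho; case: (pselect (thread C t)) => h //; exact: (root_threadP corrC).
have rhoE t : thread C t -> rho t = t by rewrite /rho; case: (pselect (thread C t)).
pose p s t := thread_pdist r (rho s) (rho t).
have pxx t : p t t = 0 by apply: thread_pdist_xx; rewrite //; exact: rhoP.
have psym s t : p s t = p t s by exact: thread_pdist_sym.
have ptri t s u : p s u <= p s t + p t u by exact: thread_pdist_triangle.
have [M [q [q_surj q_dist q_root]]] := metric_quotient pxx psym ptri (root_thread X).
exists M, q; split=> // [y|s t ts tt]; last by rewrite q_dist /p !rhoE.
have [t <-] := q_surj y; exists (rho t) => //; apply: mdist_positivity.
by rewrite q_dist /p (rhoE _ (rhoP t)); exact: pxx.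
Qed.

Context (M : pmetricType R) (q : (forall n, X n) -> M).
Hypothesis q_surj : forall y, exists2 t, thread C t & q t = y.
Hypothesis q_dist : forall s t, thread C s -> thread C t ->
  mdist (q s) (q t) = thread_pdist r s t.

Let P := prod_topology (fun n => (X n : topologicalType)).

Let q_near n s t : thread C s -> thread C t ->
  `|mdist (q s) (q t) - mdist (s n) (t n)| <= 2 * r n.
Proof. by move=> ts tt; rewrite q_dist//; exact: thread_pdist_le. Qed.

Let prod_near (t : P) n (e : R) : 0 < e -> nbhs t [set s : P | mdist (t n) (s n) < e].
Proof.
move=> e0; have := @proj_continuous nat (fun n => (X n : topologicalType)) n t.
by move=> /(_ _ (nbhs_mdist (t n) e0)).
Qed.

(** By Tychonoff only closedness is at stake. Testing two coordinates is enough for the sets at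
    hand, as the thread condition links just [t n] and [t n.+1]. *)
Let prod_compact (A : set P) :
  (forall t, (forall i j e, 0 < e -> exists s, [/\ A s,
     mdist (t i) (s i) < e & mdist (t j) (s j) < e]) -> A t) -> compact A.
Proof.
move=> clA; apply: (@subclosed_compact _ _ (setT : set P)) => //.
  move=> t At; apply: clA => i j e e0.
  have [s [As [si sj]]] := At _ (filterI (prod_near t i e0) (prod_near t j e0)).
  by exists s.
have := @tychonoff nat (fun n => (X n : topologicalType)) (fun n => setT)
  (fun n => @cmms_compact R (X n)).
by congr compact; apply/seteqP; split.
Qed.

Let thread_closed t : (forall i j e, 0 < e -> exists s, [/\ thread C s,
     mdist (t i) (s i) < e & mdist (t j) (s j) < e]) -> thread C t.
Proof.
(* The fibre of [C n] over [t n] is closed and so are the preimages of balls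
   around [t n.+1], hence the graph of [C n] is closed. *)
move=> clt n; have clC : closed (rel_image (@C n) [set t n]).
  apply: (corr_closed (corrC n).1); apply: compact_closed; last exact: compact_set1.
  exact: metric_hausdorff.
suff [_ -> //] : rel_image (@C n) [set t n] (t n.+1).
move: clC => /closed_mdistP; apply => e e0.
have clB : closed (rel_image (fun y x => C x y) [set y | mdist (t n.+1) y <= e / 2]).
  by apply: (corr_closed (corrC n).2); exact: closed_mdist_le.
have [y yt Cy] : rel_image (fun y x => C x y) [set y | mdist (t n.+1) y <= e / 2] (t n).
  move: clB => /closed_mdistP; apply => f f0.
  have [s [ts sn sn1]] := clt n n.+1 (Num.min f (e / 2)) ltac:(by rewrite lt_min f0 divr_gt0).
  exists (s n); last by rewrite (lt_le_trans sn)// ge_min lexx.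
  by exists (s n.+1) => //=; rewrite (le_trans (ltW sn1))// ge_min lexx orbT.
by exists y; [exists (t n)|rewrite (le_lt_trans yt)//; lra].
Qed.

Lemma thread_trace_compact n (A : set (X n)) : closed A ->
  compact ([set t | thread C t /\ A (t n)] : set P).
Proof.
move=> cA; apply: prod_compact => t clt; split.
  apply: thread_closed => i j e e0; have [s [[ts _] si sj]] := clt i j e e0.
  by exists s.
move: cA => /closed_mdistP; apply => e e0.
by have [s [[_ As] sn _]] := clt n n e e0; exists (s n).
Qed.

(** Distances under [q] are those in coordinate [n] up to [2 * r n], so a single coordinate with
    small [r n] controls membership in [K]. *)
Lemma thread_preimage_compact (K : set M) : closed K ->
  compact ([set t | thread C t /\ K (q t)] : set P).
Proof.
move=> cK; apply: prod_compact => t clt.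
have tt : thread C t.
  apply: thread_closed => i j e e0; have [s [[ts _] si sj]] := clt i j e e0.
  by exists s.
split=> //; move: cK => /closed_mdistP; apply => e e0.
have [|n rn] := r_cvg (e := e / 4); first lra.
have [|s [[ts Ks] sn _]] := clt n n (e / 4); first lra.
by exists (q s) => //; have := q_near n tt ts; rewrite ler_norml => /andP[]; lra.
Qed.

Lemma thread_image_compact (A : set P) : A `<=` thread C -> compact A ->
  compact (q @` A).
Proof.
move=> AC cA; apply: continuous_compact => //; apply/subspace_continuousP => t At.
apply/metricType_numDomainType.cvgrPdist_lt => e e0.
have e40 : 0 < e / 4 by lra.
have [n rn] := r_cvg e40.
apply: filterS (prod_near t n e40) => s sn As.
by have := q_near n (AC _ At) (AC _ As); rewrite ler_norml => /andP[]; move: sn => /=; lra.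
Qed.

Lemma thread_proj_closed n (A : set P) : compact A -> closed [set t n | t in A].
Proof.
move=> cA; apply: compact_closed; first exact: metric_hausdorff.
apply: continuous_compact => //; apply: continuous_subspaceT.
exact: (@proj_continuous nat (fun n => (X n : topologicalType)) n).
Qed.

Lemma thread_space_compact : compact [set: M].
Proof.
have -> : [set: M] = q @` [set t | thread C t /\ [set: M] (q t)].
  by apply/seteqP; split=> // y _; have [t tt <-] := q_surj y; exists t.
apply: thread_image_compact; first by move=> t [].
exact/thread_preimage_compact/closedT.
Qed.

End thread_space.

Section real_mass.
Context {R : realType}.
Implicit Types X Y : cmms R.

Definition mass X (A : set X) : R := fine (cmms_measure X A).

Lemma massE X (A : set X) : closed A -> cmms_measure X A = (mass A)%:E.
Proof.
by move=> cA; rewrite /mass fineK// cmms_fin//; exact: (measurable_closed X).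
Qed.

Lemma mass_ge0 X (A : set X) : 0 <= mass A.
Proof. by rewrite /mass fine_ge0. Qed.

Lemma mass0 X : mass (set0 : set X) = 0.
Proof. by rewrite /mass measure0. Qed.

Lemma mass_le X (A B : set X) : closed A -> closed B -> A `<=` B -> mass A <= mass B.
Proof. by move=> cA cB AB; rewrite -lee_fin -!massE//; exact: cmms_le. Qed.

Lemma massU_le X (A B : set X) : closed A -> closed B ->
  mass (A `|` B) <= mass A + mass B.
Proof.
move=> cA cB; rewrite -lee_fin EFinD -!massE//; last exact: closedU.
apply: (@measureU2 _ (borel X) _ (cmms_measure X));
  exact: (measurable_closed X).
Qed.

Lemma massU X (A B : set X) : closed A -> closed B -> A `&` B = set0 ->
  mass (A `|` B) = mass A + mass B.
Proof.
move=> cA cB AB; apply: EFin_inj; rewrite EFinD -!massE//; last exact: closedU.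
apply: (@measureU _ _ (borel X) (cmms_measure X)) => //;
  exact: (measurable_closed X).
Qed.

Lemma mass_corr e X Y (C : X -> Y -> Prop) (A : set X) : half_corr e C ->
  closed A -> mass A <= mass (rel_image C A) + e.
Proof.
move=> hC cA; rewrite -lee_fin EFinD -!massE//; last exact: (corr_closed hC).
exact: (corr_mass hC).
Qed.

Lemma mass_thick X (A : set X) (e : R) : closed A -> 0 < e ->
  exists2 d, 0 < d & mass (thick A d) <= mass A + e.
Proof.
move=> cA /(cmms_thick cA)[d d0 Ad]; exists d => //.
by rewrite -lee_fin EFinD -!massE//; exact: thick_closed.
Qed.

End real_mass.

(** * The measure on the limit space *)

Section limit_space.
Context {R : realType} (X : nat -> cmms R) (r : nat -> R).
Context (C : forall n, X n -> X n.+1 -> Prop).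
Hypothesis corrC : forall n, correspondence (r n - r n.+1) (@C n).
Hypothesis r_ge0 : forall n, 0 <= r n.
Hypothesis r_cvg : forall e, 0 < e -> exists n, r n < e.
Context (M : pmetricType R) (q : (forall n, X n) -> M).
Hypothesis q_surj : forall y, exists2 t, thread C t & q t = y.
Hypothesis q_dist : forall s t, thread C s -> thread C t ->
  mdist (q s) (q t) = thread_pdist r s t.
Hypothesis q_root : q (root_thread X) = point.

Let q_near n s t : thread C s -> thread C t ->
  `|mdist (q s) (q t) - mdist (s n) (t n)| <= 2 * r n.
Proof. by move=> ts tt; rewrite q_dist//; exact: thread_pdist_le. Qed.

(** The limit distance is determined by late coordinates. This is what makes splicing harmless:
    changing finitely many coordinates of a thread does not move its class. *)
Let q_tail s t n : thread C s -> thread C t ->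
  (forall m, (n <= m)%N -> s m = t m) -> q s = q t.
Proof.
move=> ts tt st; apply/mdist_positivity/eqP; rewrite eq_le mdist_ge0 andbT.
apply/ler_addgt0Pr => e e0; have [|k rk] := r_cvg (e := e / 2); first lra.
have := q_near (maxn n k) ts tt; rewrite st ?leq_maxl// mdistxx subr0.
have : r (maxn n k) <= r k.
  (* Comparing a thread with itself shows that [r] is nonincreasing. *)
  have := thread_dist corrC ts ts (leq_maxr n k).
  by rewrite !mdistxx subrr normr0; lra.
by rewrite ler_norml => ? /andP[]; lra.
Qed.

Definition limit_trace n (K : set M) : set (X n) :=
  [set t n | t in [set t | thread C t /\ K (q t)]].
Arguments limit_trace n K : clear implicits.

Definition limit_cell n (A : set (X n)) : set M :=
  q @` [set t | thread C t /\ A (t n)].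

Let trace_closed n K : closed K -> closed (limit_trace n K).
Proof.
move=> cK; apply: thread_proj_closed.
exact: (thread_preimage_compact corrC r_ge0 r_cvg q_dist cK).
Qed.

Let cell_closed n (A : set (X n)) : closed A -> closed (limit_cell A).
Proof.
move=> cA; apply: compact_closed; first exact: metric_hausdorff.
apply: (thread_image_compact corrC r_ge0 r_cvg q_dist); first by move=> t [].
exact: (thread_trace_compact corrC cA).
Qed.

(** A point related to the next coordinate of a thread over [K] lies on a thread of its own; spliced
    with the tail of the first one, this represents the same point of [K]. *)
Let trace_step n K : closed K ->
  mass (limit_trace n.+1 K) <= mass (limit_trace n K) + (r n - r n.+1).
Proof.
move=> cK; apply: (le_trans (mass_corr (corrC n).2 (@trace_closed n.+1 _ cK))).
rewrite lerD2r; apply: mass_le.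
- by apply: (corr_closed (corrC n).2); exact: trace_closed.
- exact: trace_closed.
move=> x [_ [t [tt Kt] <-] Cxt].
have [u tu un] := thread_through corrC x.
rewrite -un in Cxt *; have [s [ts su st]] := thread_splice tu tt Cxt.
exists s; last exact: su.
by split=> //; rewrite (q_tail (n := n.+1) ts tt).
Qed.

Let trace_mono n m K : closed K -> (n <= m)%N ->
  mass (limit_trace m K) + r m <= mass (limit_trace n K) + r n.
Proof.
move=> cK; elim: m => [|m ih]; first by rewrite leqn0 => /eqP ->.
rewrite leq_eqVlt => /predU1P[->//|/ih].
by have := trace_step m cK; lra.
Qed.

(** For closed [K] the sequence is nonincreasing by [trace_mono], so the infimum is the limit of the
    masses of the traces. *)
Definition limit_content (K : set M) : R :=
  inf [set mass (limit_trace n K) + r n | n in setT].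

Let content_le n K : limit_content K <= mass (limit_trace n K) + r n.
Proof.
apply: ge_inf; last by exists n.
by exists 0 => _ [m _ <-]; rewrite addr_ge0// mass_ge0.
Qed.

Let content_ge K (a : R) :
  (forall n, a <= mass (limit_trace n K) + r n) -> a <= limit_content K.
Proof.
move=> h; apply: lb_le_inf; first by exists (mass (limit_trace 0 K) + r 0%N), 0%N.
by move=> _ [n _ <-].
Qed.

Let content_near K e : closed K -> 0 < e -> exists N, forall n, (N <= n)%N ->
  mass (limit_trace n K) + r n < limit_content K + e.
Proof.
move=> cK e0; have : limit_content K < limit_content K + e by rewrite ltrDl.
move=> /inf_lt[|_ [N _ <-] KN].
  by exists (mass (limit_trace 0 K) + r 0%N), 0%N.
by exists N => n Nn; exact: le_lt_trans (trace_mono cK Nn) KN.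
Qed.

Let content_mono K L : closed K -> closed L -> K `<=` L ->
  limit_content K <= limit_content L.
Proof.
move=> cK cL KL; apply: content_ge => n; apply: (le_trans (content_le n _)).
rewrite lerD2r; apply: mass_le; [exact: trace_closed|exact: trace_closed|].
by move=> _ [t [tt Kt] <-]; exists t => //; split=> //; exact: KL.
Qed.

Let content0 : limit_content set0 = 0.
Proof.
have c0 : closed (set0 : set M) by exact: closed0.
have tr0 n : limit_trace n set0 = set0 by apply/seteqP; split=> // _ [t [_ []]].
apply/eqP; rewrite eq_le; apply/andP; split; last first.
  by apply: content_ge => n; rewrite tr0 mass0 add0r.
apply/ler_addgt0Pr => e /r_cvg[n rn].
by apply: (le_trans (content_le n _)); rewrite tr0 mass0; lra.
Qed.

Let traceU n K L : limit_trace n (K `|` L) = limit_trace n K `|` limit_trace n L.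
Proof.
apply/seteqP; split.
- by move=> _ [t [tt [Kt|Lt]] <-]; [left|right]; exists t.
- by move=> _ [[t [tt Kt] <-]|[t [tt Lt] <-]]; exists t => //; split=> //; [left|right].
Qed.

Let contentU_le K L : closed K -> closed L ->
  limit_content (K `|` L) <= limit_content K + limit_content L.
Proof.
move=> cK cL; apply/ler_addgt0Pr => e e0; have e20 : 0 < e / 2 by lra.
have [N hN] := content_near cK e20; have [N' hN'] := content_near cL e20.
have := hN _ (leq_maxl N N'); have := hN' _ (leq_maxr N N').
set n := maxn N N'; have := content_le n (K `|` L).
rewrite traceU; have := massU_le (@trace_closed n _ cK) (@trace_closed n _ cL).
by have := r_ge0 n; lra.
Qed.

(** Disjoint compact sets are at positive distance, while threads that meet in coordinate [n] are at
    limit distance at most [2 * r n]. *)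
Let trace_disjoint K L : closed K -> closed L -> K `&` L = set0 ->
  exists N, forall n, (N <= n)%N -> limit_trace n K `&` limit_trace n L = set0.
Proof.
move=> cK cL KL.
have cptM := thread_space_compact corrC r_ge0 r_cvg q_surj q_dist.
have cptK : compact K by exact: subclosed_compact cptM _.
have r_near e : 0 < e -> \forall n \near \oo, r n < e.
  move=> /r_cvg[N rN]; exists N => // n /= Nn; apply: le_lt_trans rN.
  have tr := root_threadP corrC.
  by have := thread_dist corrC tr tr Nn; rewrite !mdistxx subrr normr0; lra.
have /compact_near_coveringP/(_ _ \oo
  (fun n k => forall l, L l -> 2 * r n < mdist k l) _) := cptK.
case=> [k Kk|N _ Nh].
  have /existsNP[e /not_implyP[e0 ke]] :
      ~ (forall e, 0 < e -> exists2 l, L l & mdist k l < e).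
    move=> h; have : (K `&` L) k by split => //; move: cL => /closed_mdistP; exact.
    by rewrite KL.
  have e40 : 0 < e / 4 by lra.
  exists ([set k' | mdist k k' < e / 4], [set n | r n < e / 4]) => /=.
    by split; [exact: nbhs_mdist|exact: r_near].
  move=> [k' n] /= [kk' rn] l Ll; rewrite ltNge; apply/negP => k'l; apply: ke.
  exists l => //; have := metric_triangle k k' l; lra.
exists N => n Nn; apply/seteqP; split=> // x [[t [tt Kt] <-] [s [ts Ls] st]].
have := Nh n Nn _ Kt _ Ls; rewrite ltNge => /negP; apply.
have := q_near n tt ts; rewrite st mdistxx subr0; exact: le_trans (ler_norm _).
Qed.

Let contentU_ge K L : closed K -> closed L -> K `&` L = set0 ->
  limit_content K + limit_content L <= limit_content (K `|` L).
Proof.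
move=> cK cL KL; apply/ler_addgt0Pr => e e0; have e20 : 0 < e / 2 by lra.
have cKL : closed (K `|` L) by exact: closedU.
have [N hN] := content_near cKL e20; have [N' hN'] := trace_disjoint cK cL KL.
have [k rk] := r_cvg e20.
set n := maxn (maxn N N') k.
have nN : (N <= n)%N by rewrite /n -maxnA leq_maxl.
have nN' : (N' <= n)%N by rewrite /n (maxnC N) -maxnA leq_maxl.
have rn : r n <= r k.
  have tr := root_threadP corrC.
  have := thread_dist corrC tr tr (leq_maxr (maxn N N') k).
  by rewrite !mdistxx subrr normr0 -/n; lra.
have := hN _ nN; rewrite traceU massU ?hN'//; [|exact: trace_closed..].
have := content_le n K; have := content_le n L; lra.
Qed.

(** The neighbourhood is described at one level [n]: [U] omits the points having a thread whose
    [n]-th coordinate is at distance at least [d] from the trace of [K]. A closed subset of [U] then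
    has its trace in the [d]-thickening. *)
Let content_regular K e : closed K -> 0 < e -> exists U, [/\ open U, K `<=` U &
  forall L, closed L -> L `<=` U -> limit_content L <= limit_content K + e].
Proof.
move=> cK e0; have e20 : 0 < e / 2 by lra.
have [n /(_ n (leqnn n)) hn] := content_near cK e20.
have [d d0 hd] := mass_thick (@trace_closed n _ cK) e20.
pose B := [set x : X n | forall a, limit_trace n K a -> d <= mdist a x].
have cB : closed B.
  apply/closed_mdistP => x xB a Ka; apply/ler_addgt0Pr => f f0.
  have [y /(_ _ Ka) ay xy] := xB _ f0.
  by have := metric_triangle a x y; lra.
exists (~` limit_cell B); split.
- exact/closed_openC/cell_closed.
- move=> k Kk [t [tt Bt] tk].
  have := Bt (t n); rewrite mdistxx leNgt d0 => h.
  by suff : false by []; apply: h; exists t => //; split=> //; rewrite tk.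
move=> L cL LU; apply: (le_trans (content_le n _)).
suff : mass (limit_trace n L) <= mass (thick (limit_trace n K) d) by lra.
apply: mass_le; [exact: trace_closed|exact/thick_closed/trace_closed|].
move=> _ [t [tt Lt] <-].
have : ~ B (t n) by move=> Bt; apply: (LU _ Lt); exists t.
move=> /existsNP[a /not_implyP[Ka /negP]]; rewrite -ltNge => at_.
by exists a => //; exact: ltW.
Qed.

(** Mass is pushed forward along the threads that pass through [A]: [E m] collects their [m]-th
    coordinates, and going from level [n] to [m] loses at most [r n - r m]. Levels below [n] are
    covered by [trace_mono]. *)
Let cell_mass n (A : set (X n)) : closed A ->
  mass A <= limit_content (limit_cell A) + r n.
Proof.
move=> cA; pose E m : set (X m) := [set t m | t in [set t | thread C t /\ A (t n)]].
have cE m : closed (E m).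
  by apply: thread_proj_closed; exact: (thread_trace_compact corrC cA).
have Etrace m : E m `<=` limit_trace m (limit_cell A).
  by move=> _ [t [tt At] <-]; exists t => //; split=> //; exists t.
have AE : A = E n.
  apply/seteqP; split=> [x Ax|_ [t [_ At] <-]//].
  by have [t tt tn] := thread_through corrC x; exists t => //; split=> //; rewrite tn.
have step m : (n <= m)%N -> mass (E m) <= mass (E m.+1) + (r m - r m.+1).
  move=> nm; apply: (le_trans (mass_corr (corrC m).1 (@cE m))).
  rewrite lerD2r; apply: mass_le => //.
    exact: (corr_closed (corrC m).1 (@cE m)).
  move=> y [_ [t [tt At] <-] Cty].
  have [u tu uy] := thread_through corrC y.
  rewrite -uy in Cty *; have [s [ts st su]] := thread_splice tt tu Cty.
  by exists s; [split=> //; rewrite st|exact: su].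
have tail m : (n <= m)%N -> mass (E n) <= mass (E m) + (r n - r m).
  elim: m => [|m ih]; first by rewrite leqn0 => /eqP ->; lra.
  rewrite leq_eqVlt => /predU1P[->|nm]; first lra.
  by have := ih nm; have := step _ nm; lra.
have ccA := cell_closed cA.
rewrite -lerBlDr; apply: content_ge => m.
have [nm|mn] := leqP n m.
  have := mass_le (@cE m) (@trace_closed m _ ccA) (@Etrace m).
  by have := tail m nm; rewrite -AE; have := r_ge0 m; lra.
have := mass_le (@cE n) (@trace_closed n _ ccA) (@Etrace n).
by have := trace_mono ccA (ltnW mn); rewrite -AE; have := r_ge0 n; lra.
Qed.

Lemma limit_space : exists L : cmms R, forall n, approx (r n) (X n) L.
Proof.
have cptM := thread_space_compact corrC r_ge0 r_cvg q_surj q_dist.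
have [mu muE] := content_extension cptM content0 content_mono contentU_le
  contentU_ge content_regular.
pose L := CMMS cptM mu; exists L => n.
pose D (x : X n) (y : L) := exists t, [/\ thread C t, t n = x & q t = y].
have imE A : rel_image D A = limit_cell A.
  apply/seteqP; split=> [y [x Ax [t [tt tx ty]]]|y [t [tt At] ty]].
    by exists t => //; split=> //; rewrite tx.
  by exists (t n) => //; exists t.
have preE (K : set L) : rel_image (fun y x => D x y) K = limit_trace n K.
  apply/seteqP; split=> [x [y Ky [t [tt tx ty]]]|x [t [tt Kt] tx]].
    by exists t => //; split=> //; rewrite ty.
  by exists (q t) => //; exists t.
have Droot : D point point.
  by exists (root_thread X); split=> //; exact: (root_threadP corrC).
have Ddist x x' y y' : D x y -> D x' y' -> `|mdist y y' - mdist x x'| <= 2 * r n.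
  by move=> [t [tt <- <-]] [s [ts <- <-]]; exact: q_near.
exists D; split; split=> //.
- move=> x; have [t tt tx] := thread_through corrC x.
  by exists (q t), t.
- by move=> x x' y y' Dx Dx'; have := Ddist _ _ _ _ Dx Dx'; rewrite ler_norml => /andP[]; lra.
- by move=> A cA; rewrite imE; exact: cell_closed.
- move=> A cA; rewrite imE massE// (muE _ (cell_closed cA)) -EFinD lee_fin.
  exact: cell_mass.
- by move=> y; have [t tt ty] := q_surj y; exists (t n), t.
- by move=> y y' x x' Dx Dx'; have := Ddist _ _ _ _ Dx Dx'; rewrite ler_norml => /andP[]; lra.
- by move=> K cK; rewrite preE; exact: trace_closed.
- move=> K cK; rewrite preE (muE _ cK) massE; last exact: trace_closed.
  by rewrite -EFinD lee_fin.
Qed.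

End limit_space.

(** * Complete metric on full-support spaces *)

Section graded_metric.
Context {R : realType} (T : Type) (P : R -> T -> T -> Prop).
Hypothesis Prefl : forall e x, 0 < e -> P e x x.
Hypothesis Psym : forall e x y, P e x y -> P e y x.
Hypothesis Ptrans : forall e f x y z, 0 < e -> 0 < f ->
  P e x y -> P f y z -> P (e + f) x z.
Hypothesis Ple : forall e f x y, e <= f -> P e x y -> P f x y.
Hypothesis Pex : forall x y, exists2 e, 0 < e & P e x y.
Hypothesis Psep : forall x y, (forall e, 0 < e -> P e x y) -> x = y.

Definition graded_dist (x y : T) : R := inf [set e | 0 < e /\ P e x y].

Lemma graded_dist_lt e x y : graded_dist x y < e -> P e x y.
Proof.
move=> /inf_lt[|f [_ Pf] /ltW fe]; last exact: Ple Pf.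
by have [f f0 Pf] := Pex x y; exists f.
Qed.

Lemma graded_dist_le e x y : 0 < e -> P e x y -> graded_dist x y <= e.
Proof. by move=> e0 Pe; apply: ge_inf => //; exists 0 => f [/ltW]. Qed.

Lemma graded_dist_ge0 x y : 0 <= graded_dist x y.
Proof.
by apply: lb_le_inf => [|f [/ltW]//]; have [f f0 Pf] := Pex x y; exists f.
Qed.

Lemma graded_metric : is_metric graded_dist.
Proof.
split.
- move=> x; apply/eqP; rewrite eq_le graded_dist_ge0 andbT.
  by apply/ler_addgt0Pr => e e0; rewrite add0r graded_dist_le//; exact: Prefl.
- by move=> x y xy; apply: Psep => e e0; apply: graded_dist_lt; rewrite xy.
- by move=> x y; congr inf; apply/seteqP; split=> e [e0 /Psym].
- move=> y x z; apply/ler_addgt0Pr => e e0; have e20 : 0 < e / 2 by lra.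
  have := graded_dist_ge0 x y; have := graded_dist_ge0 y z => yz0 xy0.
  have := @graded_dist_lt (graded_dist x y + e / 2) x y ltac:(lra).
  have := @graded_dist_lt (graded_dist y z + e / 2) y z ltac:(lra).
  move=> Pyz Pxy; have := graded_dist_le _ (Ptrans _ _ Pxy Pyz).
  by move=> /(_ ltac:(lra) ltac:(lra) ltac:(lra)); lra.
Qed.

End graded_metric.

Section spread.
Context {R : realType}.
Implicit Types X Y : cmms R.

Definition cball X (x : X) (e : R) : set X := [set y | mdist x y <= e].

Lemma cball_closed X (x : X) e : closed (cball x e).
Proof. exact: closed_mdist_le. Qed.

Let good k X := [set c : R | forall x : X, c <= mass (cball x (k.+1%:R^-1 - 2 * c))].

(* Positive exactly when, for some radius below [1 / (k + 1)], the masses of the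
   balls are bounded away from zero; the coefficient 2 in the radius is the one in
   [corr_dist] and makes [spread k] 1-Lipschitz. *)
Definition spread k X : R := sup (good k X).

Let good0 k X : good k X 0.
Proof. by move=> x; exact: mass_ge0. Qed.

Let good_ub k X : ubound (good k X) (mass (setT : set X)).
Proof.
move=> c /(_ point) /le_trans; apply; apply: mass_le => //.
exact: cball_closed.
Qed.

Lemma spread_lipschitz k e X Y : approx e X Y -> spread k X <= spread k Y + e.
Proof.
move=> [C [C1 C2]]; apply: ge_sup; first by exists 0; exact: good0.
(* [c - e] is admissible for [Y]: a relation of size [e] enlarges the radius by [2 * e] and costs
   mass [e], and lowering [c] by [e] allows for both. *)
move=> c gc; rewrite -lerBlDr; apply: ub_le_sup.
  by exists (mass (setT : set Y)); exact: good_ub.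
move=> y; have [x Cxy] := corr_total C2 y.
rewrite lerBlDr; apply: (le_trans (gc x)).
apply: (le_trans (mass_corr C1 (@cball_closed X x _))).
rewrite lerD2r; apply: mass_le.
- by apply: (corr_closed C1); exact: cball_closed.
- exact: cball_closed.
- move=> y' [x' xx' Cxy']; have := corr_dist C2 Cxy Cxy'.
  by move: xx'; rewrite /cball/=; move: (k.+1%:R^-1 : R) => d; lra.
Qed.

Lemma spread_gt0 k X : measure_support X = setT -> 0 < spread k X.
Proof.
move=> fullX; pose d : R := k.+1%:R^-1; have d0 : 0 < d by rewrite invr_gt0.
have d40 : 0 < d / 4 by lra.
have /compact_near_coveringP/(_ _ \oo
  (fun n (x : X) => n.+1%:R^-1 <= mass (cball x (d / 2))) _) := @cmms_compact R X.
case=> [x _|N _ /(_ N (leqnn N)) h].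
  have m0 : 0 < mass (cball x (d / 4)).
    rewrite -lte_fin -massE; last exact: cball_closed.
    have fx : measure_support X x by rewrite fullX.
    have nb := nbhs_mdist x d40.
    apply: (@lt_le_trans _ _ (cmms_measure X ([set y | mdist x y < d / 4]°))).
      by apply: fx; [exact: open_interior|exact: nb].
    apply: le_measure_borel.
    - by apply: sub_sigma_algebra; exact: open_interior.
    - by apply: (measurable_closed X); exact: cball_closed.
    - by move=> y /interior_subset /ltW.
  exists ([set y | mdist x y < d / 4],
    [set n | n.+1%:R^-1 < mass (cball x (d / 4))]) => /=.
    split; first exact: nbhs_mdist.
    exact: (near_infty_natSinv_lt (PosNum m0)).
  move=> [y n] /= [xy /ltW nm]; apply: (le_trans nm).
  apply: mass_le; [exact: cball_closed|exact: cball_closed|].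
  move=> z /= xz; have := metric_triangle y x z; move: xz.
  by rewrite /cball/= (metric_sym y x); lra.
(* The bound [d / 4] keeps the radius [d - 2 * c] at least [d / 2]. *)
pose c : R := Num.min N.+1%:R^-1 (d / 4).
have c0 : 0 < c by rewrite lt_min d40 invr_gt0 ltr0n.
apply: (lt_le_trans c0); apply: ub_le_sup.
  by exists (mass (setT : set X)); exact: good_ub.
move=> x; apply: (@le_trans _ _ N.+1%:R^-1); first by rewrite ge_min lexx.
apply: (le_trans (h x I)).
apply: mass_le; [exact: cball_closed|exact: cball_closed|].
have cd : c <= d / 4 by rewrite ge_min lexx orbT.
by move=> y; rewrite /cball/= -/d; lra.
Qed.

Lemma full_support X : (forall k, 0 < spread k X) -> measure_support X = setT.
Proof.
move=> h; apply/seteqP; split=> // x _ U oU Ux.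
have := open_nbhs_nbhs (conj oU Ux).
move=> /metricType_numDomainType.nbhs_mdistP[e /= e0 eU].
have [k _ /(_ k (leqnn k)) /= ke] := near_infty_natSinv_lt (PosNum e0).
have [|c gc c0] := @sup_gt _ (good k X) 0 _ (h k); first by exists 0; exact: good0.
apply: (@lt_le_trans _ _ c%:E); first by rewrite lte_fin.
apply: (@le_trans _ _ (mass (cball x (k.+1%:R^-1 - 2 * c)))%:E).
  by rewrite lee_fin; exact: gc.
rewrite -massE; last exact: cball_closed.
apply: le_measure_borel.
- by apply: (measurable_closed X); exact: cball_closed.
- by apply: sub_sigma_algebra.
- by move=> y xy; apply: eU => /=; move: xy ke; rewrite /cball/=; move: (k.+1%:R^-1 : R) => d; lra.
Qed.

End spread.

Section Xc_approx.
Context {R : realType}.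
Implicit Types x y z : Xc R.

Definition xapprox (e : R) x y := approx e (repr x) (repr y).

Lemma repr_pi_equiv (X : cmms R) : strong_equiv (repr (\pi_(Xc R) X)%qT) X.
Proof.
suff /asboolP : strong_eq_equiv R (repr (\pi_(Xc R) X)%qT) X by [].
by apply/eqmodP; rewrite reprK.
Qed.

Lemma xapprox_eq x y : (forall e, 0 < e -> xapprox e x y) -> x = y.
Proof.
move=> /approx_indiscernible xy; rewrite -[x]reprK -[y]reprK.
by apply/eqmodP/asboolP.
Qed.

Lemma xapprox_pi e (X : cmms R) : 0 <= e -> approx e (repr (\pi_(Xc R) X)%qT) X.
Proof. by move=> e0; apply: strong_equiv_approx => //; exact: repr_pi_equiv. Qed.

Lemma xapprox_refl e x : 0 <= e -> xapprox e x x.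
Proof. by move=> e0; apply: strong_equiv_approx => //; exact: strong_equiv_refl. Qed.

(** Balls of [ghp] are not known to be open. In [V] the strict [d < e] leaves room for a further
    step of [ghp]-size below [e - d], which makes [V] open. *)
Lemma xapprox_nbhs e x : 0 < e -> nbhs x [set y | xapprox e x y].
Proof.
move=> e0; pose V := [set y | exists2 d, d < e & xapprox d x y].
have oV : open V.
  rewrite /open /= => y [d de xy]; exists (e - d); first by rewrite subr_gt0.
  move=> z /= yz; pose g := (ghp y z + (e - d)) / 2.
  exists (d + g); first by rewrite /g; lra.
  by apply: approx_trans xy _; apply: ghp_approx; rewrite -/(ghp y z) /g; lra.
apply: (@filterS _ (nbhs x) _ V).
  by move=> y [d /ltW de xy]; exact: approx_le xy.
apply: open_nbhs_nbhs; split=> //; exists (e / 2); first lra.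
by apply: xapprox_refl; lra.
Qed.

Lemma nbhs_xapprox x U : nbhs x U ->
  exists2 e : R, 0 < e & [set y | xapprox e x y] `<=` U.
Proof.
rewrite nbhsE => -[V [oV Vx] VU]; have [e e0 eV] := oV x Vx.
exists (e / 4); first lra.
move=> y xy; apply/VU/eV => /=.
by have := @approx_ghp_le _ (e / 4) _ _ ltac:(lra) xy; rewrite -/(ghp x y); lra.
Qed.

Lemma xapprox_spread k e x y : xapprox e x y ->
  `|spread k (repr x) - spread k (repr y)| <= e.
Proof.
move=> xy; have := spread_lipschitz k xy.
by have := spread_lipschitz k (approx_sym xy); rewrite ler_norml => ? ?; apply/andP; split; lra.
Qed.

Lemma Xc_suppP x : Xc_supp R x <-> forall k, 0 < spread k (repr x).
Proof.
split=> [xs k|]; last exact: full_support.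
exact: spread_gt0.
Qed.

End Xc_approx.

(** The first bound keeps [b] at least [a / 2], so the difference of the inverses,
    [|a - b| / (a * b)], is at most [2 * |a - b| / a ^+ 2]. *)
Lemma inv_dist_le (R : realType) (a b e : R) : 0 < a ->
  `|a - b| <= Num.min (a / 2) (e * a ^+ 2 / 2) -> `|a^-1 - b^-1| <= e.
Proof.
move=> a0; rewrite le_min => /andP[ab abe].
have b0 : a / 2 <= b by move: ab; rewrite ler_norml => /andP[]; lra.
have bp : 0 < b by lra.
have -> : a^-1 - b^-1 = (b - a) / (a * b).
    rewrite mulrBl invfM mulrCA mulfV ?gt_eqF// mulr1 mulrA mulfV ?gt_eqF//.
    by rewrite mul1r.
rewrite normrM normfV (gtr0_norm (mulr_gt0 a0 bp)) distrC.
rewrite ler_pdivrMr ?mulr_gt0//; apply: (le_trans abe).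
have e0 : 0 <= e.
  have : 0 <= e * a ^+ 2 / 2 by apply: le_trans abe.
  by rewrite ler_pdivlMr// mul0r pmulr_lge0// exprn_gt0.
have : 0 <= e * a * (b - a / 2) by rewrite !mulr_ge0 ?(ltW a0) ?subr_ge0.
by rewrite expr2; nra.
Qed.

Lemma approx_limit (R : realType) (X : nat -> cmms R) (r : nat -> R) :
  (forall n, 0 <= r n) -> (forall e, 0 < e -> exists n, r n < e) ->
  (forall n, approx (r n - r n.+1) (X n) (X n.+1)) ->
  exists L : cmms R, forall n, approx (r n) (X n) L.
Proof.
move=> r_ge0 r_cvg XX; pose C n := sval (cid (XX n)).
have corrC n : correspondence (r n - r n.+1) (C n) := svalP (cid (XX n)).
have [M [q [q_surj q_dist q_root]]] := thread_quotient corrC r_ge0 r_cvg.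
exact: (limit_space corrC r_ge0 r_cvg q_surj q_dist q_root).
Qed.

Lemma cauchy_forP (R : realType) (T : Type) (d : T -> T -> R) (u : nat -> T) :
  cauchy_for d u -> forall e, 0 < e ->
  exists N, forall m n, (N <= m)%N -> (N <= n)%N -> d (u m) (u n) < e.
Proof.
move=> cu e /cu[[A B] /= [[N _ NA] [N' _ NB]] h].
exists (maxn N N') => m n; rewrite !geq_max => /andP[Nm _] /andP[_ Nn].
by apply: (h (m, n)); split; [exact: NA|exact: NB].
Qed.

Section polish_metric.
Context {R : realType}.
Implicit Types x y z : Xc_supp R.

Let sp k x : R := spread k (repr (set_val x)).

Let sp_gt0 k x : 0 < sp k x.
Proof. by move: k; apply/Xc_suppP/set_valP. Qed.

(* The condition on the inverse spreads keeps Cauchy sequences away from the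
   complement of [Xc_supp]; only finitely many [k] are constrained at scale [e]. *)
Definition supp_close (e : R) x y : Prop :=
  xapprox e (set_val x) (set_val y) /\
  forall k, e <= k.+1%:R^-1 -> `|(sp k x)^-1 - (sp k y)^-1| <= e.

Let close_refl e x : 0 < e -> supp_close e x x.
Proof.
move=> e0; split; first by apply: xapprox_refl; exact: ltW.
by move=> k _; rewrite subrr normr0 ltW.
Qed.

Let close_sym e x y : supp_close e x y -> supp_close e y x.
Proof.
by move=> [xy h]; split=> [|k ek]; [exact: approx_sym|rewrite distrC; exact: h].
Qed.

(** A larger scale constrains fewer [k]: those constrained at [e + f] are constrained at both [e]
    and [f]. *)
Let close_trans e f x y z : 0 < e -> 0 < f ->
  supp_close e x y -> supp_close f y z -> supp_close (e + f) x z.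
Proof.
move=> e0 f0 [xy hxy] [yz hyz]; split=> [|k ek]; first exact: approx_trans xy yz.
rewrite (le_trans (ler_distD (sp k y)^-1 _ _))// lerD//.
  by apply: hxy; apply: le_trans ek; rewrite lerDl ltW.
by apply: hyz; apply: le_trans ek; rewrite lerDr ltW.
Qed.

Let close_le e f x y : e <= f -> supp_close e x y -> supp_close f x y.
Proof.
move=> ef [xy h]; split=> [|k fk]; first exact: approx_le xy.
by rewrite (le_trans _ ef)// h// (le_trans ef).
Qed.

Let close_ex x y : exists2 e, 0 < e & supp_close e x y.
Proof.
have [e e0 xy] := approx_ex (repr (set_val x)) (repr (set_val y)).
(* Beyond scale 1 no [k] is constrained. *)
exists (e + 1); first lra.
split=> [|k]; first by apply: approx_le xy; lra.
have : (k.+1%:R^-1 : R) <= 1 by rewrite invf_le1// ler1n.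
by move=> k1 ek; exfalso; move: (le_trans ek k1); rewrite leNgt ltrDr e0.
Qed.

Let close_sep x y : (forall e, 0 < e -> supp_close e x y) -> x = y.
Proof. by move=> h; apply: val_inj; apply: xapprox_eq => e /h[]. Qed.

Definition supp_dist : Xc_supp R -> Xc_supp R -> R := graded_dist supp_close.

(** Finitely many [k] are constrained at scale [e], and each inverse spread is continuous at [x]
    because the spread is positive there. *)
Let close_near x e : 0 < e ->
  exists2 d, 0 < d & forall y, xapprox d (set_val x) (set_val y) -> supp_close e x y.
Proof.
move=> e0.
have near1 k : exists2 d, 0 < d & forall y,
    xapprox d (set_val x) (set_val y) -> `|(sp k x)^-1 - (sp k y)^-1| <= e.
  pose s := sp k x; have s0 : 0 < s by exact: sp_gt0.
  exists (Num.min (s / 2) (e * s ^+ 2 / 2)).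
    by rewrite lt_min !divr_gt0// mulr_gt0// exprn_gt0.
  by move=> y /(xapprox_spread k); exact: inv_dist_le.
have nearN N : exists2 d, 0 < d & forall y, xapprox d (set_val x) (set_val y) ->
    forall k, (k < N)%N -> `|(sp k x)^-1 - (sp k y)^-1| <= e.
  elim: N => [|N [d d0 hd]]; first by exists 1.
  have [f f0 hf] := near1 N; exists (Num.min d f); first by rewrite lt_min d0.
  move=> y xy k; rewrite ltnS leq_eqVlt => /predU1P[->|kN].
    by apply: hf; apply: approx_le xy; rewrite ge_min lexx orbT.
  by apply: hd kN; apply: approx_le xy; rewrite ge_min lexx.
have [N _ /(_ N (leqnn N)) /= Ne] := near_infty_natSinv_lt (PosNum e0).
have [d d0 hd] := nearN N; exists (Num.min d e); first by rewrite lt_min d0.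
move=> y xy; split; first by apply: approx_le xy; rewrite ge_min lexx orbT.
move=> k ek; apply: hd; first by apply: approx_le xy; rewrite ge_min lexx.
rewrite ltnNge; apply/negP => Nk.
have : (k.+1%:R^-1 : R) <= N.+1%:R^-1 by rewrite lef_pV2 ?posrE// ler_nat.
by move=> kN; move: (le_trans ek kN); rewrite leNgt Ne.
Qed.

Let supp_dist_lt e x y : supp_dist x y < e -> supp_close e x y.
Proof. exact: (graded_dist_lt close_le close_ex). Qed.

Let supp_dist_le e x y : 0 < e -> supp_close e x y -> supp_dist x y <= e.
Proof. exact: graded_dist_le. Qed.

Lemma supp_dist_metrizes : metrizes supp_dist.
Proof.
split.
  exact: (graded_metric close_refl close_sym close_trans close_le close_ex close_sep).
move=> x; apply/seteqP; split=> U.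
- case=> _ /= [] [W oW <- /= Wx sWU].
  have [e e0 eW] := nbhs_xapprox (open_nbhs_nbhs (conj oW Wx)).
  by exists e => // y /supp_dist_lt[/eW Wy _]; exact: sWU.
- case=> e /= e0 eU; have e20 : 0 < e / 2 by lra.
  have [d d0 hd] := close_near x e20.
  have nx : nbhs x (set_val @^-1` [set y | xapprox d (set_val x) y]).
    exact: (@initial_continuous _ _ (@set_val _ (Xc_supp R)) x _ (xapprox_nbhs _ d0)).
  apply: (@filterS _ (nbhs x) _ _ _ _ nx) => y /hd xy.
  by apply: eU => /=; have := supp_dist_le e20 xy; lra.
Qed.

Lemma supp_dist_complete : complete_for supp_dist.
Proof.
move=> u /cauchy_forP cu.
(* For powers of 2 the size [r n - r n.+1] asked for by [approx_limit] is again [r n.+1]. *)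
pose r n : R := 1 / 2 ^+ n.
have r0 n : 0 < r n by rewrite divr_gt0// exprn_gt0.
have rS n : r n - r n.+1 = r n.+1.
  by rewrite /r exprS invfM mulrA; move: (2 ^+ n)^-1 => t; lra.
have r_cvg e : 0 < e -> exists N, forall n, (N <= n)%N -> r n < e.
  by move=> e0; have [N _ h] := near_infty_natSinv_expn_lt (PosNum e0); exists N.
have /choice[phi phiE] k : exists N, forall m n, (N <= m)%N -> (N <= n)%N ->
    supp_dist (u m) (u n) < r k.+1.
  exact: cu.
(* Summing makes [N] nondecreasing and at least both [phi k] and [k]. *)
pose N k := (\sum_(i < k.+1) (phi i + i))%N.
have phiN k : (phi k <= N k)%N.
  by rewrite /N big_ord_recr/= addnCA leq_addr.
have NS k : (N k <= N k.+1)%N by rewrite /N [leqRHS]big_ord_recr/= leq_addr.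
have kN k : (k <= N k)%N by rewrite /N big_ord_recr/= addnA leq_addl.
have tail k n : (N k <= n)%N -> xapprox (r k.+1) (set_val (u (N k))) (set_val (u n)).
  move=> Nn; have /supp_dist_lt[] // := phiE k (N k) n (phiN k) (leq_trans (phiN k) Nn).
have [|e e0|n|L hL] := @approx_limit R (fun k => repr (set_val (u (N k)))) r.
- by move=> n; exact: ltW.
- by have [k h] := r_cvg e e0; exists k; exact: h.
- by rewrite rS; exact: tail.
pose l : Xc R := (\pi_(Xc R) L)%qT.
have ul k : xapprox (r k + r k) (set_val (u (N k))) l.
  apply: approx_trans (hL k) _; apply: approx_sym.
  by apply: xapprox_pi; exact: ltW.
(* At scale [j.+1%:R^-1] the index [j] is constrained, so [sp j] stays at least [M^-1] along the
   tail of the sequence. Passing to the limit costs at most [2 * r i], less than half of that. *)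
have lS : Xc_supp R l.
  apply/Xc_suppP => j; pose e : R := j.+1%:R^-1.
  have e0 : 0 < e by rewrite invr_gt0.
  have [K hK] := cu e e0.
  pose M := (sp j (u K))^-1 + e.
  have M0 : 0 < M by rewrite addr_gt0// invr_gt0.
  have uM m : (K <= m)%N -> M^-1 <= sp j (u m).
    move=> Km; have /supp_dist_lt[_ /(_ j (lexx _))] := hK K m (leqnn K) Km.
    rewrite ler_norml => /andP[h _]; rewrite -[leRHS]invrK lef_pV2 ?posrE ?invr_gt0//.
    by move: h; rewrite -/e /M; move: (_^-1) (_^-1) => a b; lra.
  have M40 : 0 < M^-1 / 4 by rewrite divr_gt0// invr_gt0.
  have [k hk] := r_cvg _ M40; pose i := maxn k K.
  have := uM (N i) (leq_trans (leq_maxr k K) (kN i)).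
  have := hk i (leq_maxl k K); have := xapprox_spread j (ul i).
  rewrite -/(sp j (u (N i))) ler_norml => /andP[_].
  by move: M40; move: (M^-1) => a; lra.
pose l' : Xc_supp R := exist _ l (mem_set lS); exists l'.
apply/cvgrPdist_lt => e e0; have e20 : 0 < e / 2 by lra.
have [d d0 hd] := close_near l' e20.
have d40 : 0 < d / 4 by lra.
have [k /(_ k (leqnn k)) hk] := r_cvg _ d40.
exists (N k) => // n /= Nn; have [md _] := supp_dist_metrizes.
(* From [l] to [u (N k)] the size is [2 * r k], from there to [u n] it is [r k.+1]; together this is
   below [d]. *)
have ln : supp_close (e / 2) l' (u n).
  apply: hd; apply: approx_le (approx_trans (approx_sym (ul k)) (tail k n Nn)).
  by have := rS k; have := r0 k.+1; lra.
rewrite sub0r normrN (is_metric_sym md) ger0_norm; last exact: graded_dist_ge0 close_ex _ _.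
by have := supp_dist_le e20 ln; lra.
Qed.

End polish_metric.

(** * Separability *)

Section separability.
Context {R : realType}.
Implicit Types X Y : cmms R.

Lemma finite_net X (e : R) : 0 < e -> exists n (f : 'I_n.+1 -> X),
  f ord0 = point /\ forall x, exists i, mdist (f i) x <= e.
Proof.
move=> e0.
have [s sP] : exists s : seq X, forall x, exists2 y, y \in s & mdist y x <= e.
  have := @cmms_compact R X; rewrite compact_cover.
  move=> /(_ X setT (fun y => [set x | mdist y x < e]°)); case=> [y _||D _ hD].
  - exact: open_interior.
  - by move=> x _; exists x => //; exact: nbhs_mdist.
  - exists (finmap.enum_fset D) => x; have [y /= yD yx] := hD x I.
    by exists y => //; exact/ltW/(interior_subset yx).
exists (size s), (fun i => nth point (point :: s) i); split=> // x.
have [y ys yx] := sP x.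
have yi : (index y (point :: s) < (size s).+1)%N.
  by rewrite -[X in (_ < X)%N]/(size (point :: s)) index_mem inE ys orbT.
by exists (Ordinal yi); rewrite /= nth_index// inE ys orbT.
Qed.

Definition ball_union X n (f : 'I_n.+1 -> X) (e : R) (I : {set 'I_n.+1}) : set X :=
  \bigcup_(i in [set` I]) cball (f i) e.

Lemma ball_union_closed X n (f : 'I_n.+1 -> X) e I : closed (ball_union f e I).
Proof. by apply: closed_bigcup => // i _; exact: cball_closed. Qed.

(** Masses are recorded for all unions of net balls because these are exactly the images of sets
    under the relation of lying near a common net index. *)
Definition net_code X n (e : R) (f : 'I_n.+1 -> X) :
    {ffun 'I_n.+1 * 'I_n.+1 -> nat} * {ffun {set 'I_n.+1} -> nat} :=
  ([ffun p => Num.truncn (mdist (f p.1) (f p.2) / e)],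
   [ffun I => Num.truncn (mass (ball_union f e I) / e)]).

Lemma truncn_eq_le (a b e : R) : 0 < e -> 0 <= a -> 0 <= b ->
  Num.truncn (a / e) = Num.truncn (b / e) -> a <= b + e.
Proof.
move=> e0 a0 b0 ab.
have /truncn_itv/andP[_] : 0 <= a / e by rewrite divr_ge0// ltW.
have /truncn_itv/andP[+ _] : 0 <= b / e by rewrite divr_ge0// ltW.
rewrite ab -natr1 => hb ha.
have : a / e < b / e + 1 by rewrite (lt_le_trans ha)// lerD2r.
by rewrite ltr_pdivrMr// mulrDl divfK ?gt_eqF// mul1r => /ltW.
Qed.

(** Moving four points to the net costs [4 * e] and rounding of distances another [e], which fits
    into the allowed [2 * (3 * e)]. Masses lose only the rounding error [e]. *)
Lemma net_code_half X Y n (e : R) (f : 'I_n.+1 -> X) (g : 'I_n.+1 -> Y) :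
  0 < e -> f ord0 = point -> g ord0 = point ->
  (forall x, exists i, mdist (f i) x <= e) ->
  net_code e f = net_code e g ->
  half_corr (3 * e) (fun x y => exists i, mdist (f i) x <= e /\ mdist (g i) y <= e).
Proof.
move=> e0 f0 g0 fnet fg.
have imE A : rel_image (fun x y => exists i, mdist (f i) x <= e /\ mdist (g i) y <= e) A
    = ball_union g e [set i | `[< exists2 x, A x & mdist (f i) x <= e >]].
  apply/seteqP; split=> [y [x Ax [i [fx gy]]]|y [i]].
    by exists i => //=; rewrite inE; apply/asboolP; exists x.
  by rewrite /= inE => /asboolP[x Ax fx] gy; exists x => //; exists i.
split.
- by exists ord0; rewrite f0 g0 !mdistxx ltW.
- by move=> x; have [i fx] := fnet x; exists (g i), i; split=> //; rewrite mdistxx ltW.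
- move=> x x' y y' [i [fx gy]] [j [fx' gy']].
  have : mdist (f i) (f j) <= mdist (g i) (g j) + e.
    apply: truncn_eq_le => //; try exact: mdist_ge0.
    by move/(congr1 fst)/ffunP/(_ (i, j)) : fg; rewrite /= !ffunE.
  have := metric_triangle x (f i) x'; have := metric_triangle (f i) (f j) x'.
  have := metric_triangle (g i) y (g j); have := metric_triangle y y' (g j).
  by rewrite (metric_sym x (f i)) (metric_sym y' (g j)); lra.
- by move=> A cA; rewrite imE; exact: ball_union_closed.
- move=> A cA; rewrite imE; set I := [set i | _]%SET.
  rewrite !massE//; last exact: ball_union_closed.
  rewrite -EFinD lee_fin; apply: (@le_trans _ _ (mass (ball_union f e I))).
    apply: mass_le => //; first exact: ball_union_closed.
    move=> x Ax; have [i fx] := fnet x; exists i => //=.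
    by rewrite inE; apply/asboolP; exists x.
  have : mass (ball_union f e I) <= mass (ball_union g e I) + e.
    apply: truncn_eq_le => //; try exact: mass_ge0.
    by move/(congr1 snd)/ffunP/(_ I) : fg; rewrite /= !ffunE.
  lra.
Qed.

Lemma net_code_approx X Y n (e : R) (f : 'I_n.+1 -> X) (g : 'I_n.+1 -> Y) :
  0 < e -> f ord0 = point -> g ord0 = point ->
  (forall x, exists i, mdist (f i) x <= e) ->
  (forall y, exists i, mdist (g i) y <= e) ->
  net_code e f = net_code e g -> approx (3 * e) X Y.
Proof.
move=> e0 f0 g0 fnet gnet fg.
exists (fun x y => exists i, mdist (f i) x <= e /\ mdist (g i) y <= e).
split; first exact: net_code_half.
have -> : (fun (y : Y) (x : X) => exists i, mdist (f i) x <= e /\ mdist (g i) y <= e) =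
    (fun y x => exists i, mdist (g i) y <= e /\ mdist (f i) x <= e).
  by apply/funext => y; apply/funext => x; apply/propext; split=> -[i []]; exists i.
exact: net_code_half.
Qed.

Lemma approx_code (e : R) : 0 < e ->
  exists c : cmms R -> nat, forall X Y, c X = c Y -> approx e X Y.
Proof.
move=> e0; have e30 : 0 < e / 3 by lra.
pose net X := cid (finite_net X e30).
pose N X : nat := sval (net X).
pose F X : 'I_(N X).+1 -> X := sval (cid (svalP (net X))).
have FP X : F X ord0 = point /\ forall x, exists i, mdist (F X i) x <= e / 3 :=
  svalP (cid (svalP (net X))).
(* The size [N X] is encoded as well, since the type of the net code depends on it. *)
exists (fun X => pickle (N X, pickle (net_code (e / 3) (F X)))).
move=> X Y /(pcan_inj pickleK)[].
move: (F X) (F Y) (FP X).1 (FP X).2 (FP Y).1 (FP Y).2.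
move: (N X) (N Y) => n m f g f0 fnet g0 gnet nm; case: m / nm g g0 gnet => g g0 gnet.
move=> /(pcan_inj pickleK) /(net_code_approx e30 f0 g0 fnet gnet).
by apply: approx_le; lra.
Qed.

(** One full-support space is chosen for each scale and each code that occurs. Choosing inside
    [Xc_supp R] avoids having to approximate by finite spaces and to arrange full support for
    these. *)
Lemma separable_Xc_supp : separable (Xc_supp R).
Proof.
have e0 n : 0 < (n.+1%:R^-1 : R) by rewrite invr_gt0.
have /choice[c cP] n := approx_code (e0 n).
pose code n (x : Xc_supp R) := c n (repr (set_val x)).
pose f n m : option (Xc_supp R) :=
  if pselect (exists x, code n x = m) is left h then Some (sval (cid h)) else None.
exists (\bigcup_n \bigcup_m [set x | f n m = Some x]).
  apply: bigcup_countable => // n _; apply: bigcup_countable => // m _.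
  case: (f n m) => [x|].
    apply: (sub_countable _ (countable1 x)); apply: subset_card_le.
    by move=> y /= [->].
  apply: (sub_countable _ (countable0 _)); apply: subset_card_le.
  by move=> y.
move=> U [x Ux] oU.
have := open_nbhs_nbhs (conj oU Ux); case=> _ /= [] [W oW <- /= Wx sWU].
have [e eP eW] := nbhs_xapprox (open_nbhs_nbhs (conj oW Wx)).
have [n _ /(_ n (leqnn n)) /= ne] := near_infty_natSinv_lt (PosNum eP).
have hx : exists y, code n y = code n x by exists x.
pose y := sval (cid hx).
exists y; split.
  apply: sWU; apply: eW => /=; apply: approx_le (ltW ne) _.
  by apply: cP; exact: (esym (svalP (cid hx))).
exists n => //; exists (code n x) => //=; rewrite /f.
case: pselect => [h|/(_ hx)//].
by rewrite /y (Prop_irrelevance h hx).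
Qed.

End separability.

(** * Failure of completeness *)

Section not_complete.
Context {R : realType}.

Lemma point_space_ex (c : R) : 0 < c ->
  exists X : cmms R, (forall x y : X, x = y) /\ cmms_measure X setT = c%:E.
Proof.
move=> c0; have tri (y x z : unit) : (0 : R) <= 0 + 0 by rewrite addr0.
have [M [q [q_surj _ _]]] := @metric_quotient R unit (fun _ _ => 0)
  (fun=> erefl) (fun _ _ => erefl) tri tt.
have M1 (x y : M) : x = y.
  by have [[] <-] := q_surj x; have [[] <-] := q_surj y.
have cM : compact [set: M].
  suff -> : [set: M] = [set point] by exact: compact_set1.
  by apply/seteqP; split=> // x _; exact: M1.
pose mu : {finite_measure set (borel M) -> \bar R} :=
  mscale (NngNum (ltW c0)) (dirac (point : borel M)).
exists (CMMS cM mu); split=> //=.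
by rewrite /mscale /= diracT mule1.
Qed.

Lemma point_space_subset (X : cmms R) (A : set X) : (forall x y : X, x = y) ->
  A = set0 \/ A = setT.
Proof.
move=> X1; have [?|/set0P[a Aa]] := eqVneq A set0; [by left|right].
by apply/seteqP; split=> // x _; rewrite (X1 x a).
Qed.

Lemma point_space_support (X : cmms R) : (forall x y : X, x = y) ->
  (0 < cmms_measure X setT)%E -> measure_support X = setT.
Proof.
move=> X1 mX; apply/seteqP; split=> // x _ U oU Ux.
have [U0|->//] := point_space_subset U X1.
by move: Ux; rewrite U0.
Qed.

Lemma point_space_half (X Y : cmms R) (e : R) : 0 <= e ->
  (forall x y : X, x = y) -> (forall x y : Y, x = y) ->
  mass (setT : set X) <= mass (setT : set Y) + e ->
  half_corr e (fun (_ : X) (_ : Y) => True).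
Proof.
move=> e0 X1 Y1 XY; split=> //.
- by move=> x; exists point.
- by move=> x x' y y' _ _; rewrite (X1 x x') mdistxx; have := mdist_ge0 y y'; lra.
- move=> A _; set B := rel_image _ _.
  by have [->|->] := point_space_subset B Y1; [exact: closed0|exact: closedT].
- move=> A cA; have [->|AT] := point_space_subset A X1.
    by rewrite measure0 adde_ge0.
  have -> : rel_image (fun (_ : X) (_ : Y) => True) A = setT.
    by apply/seteqP; split=> // y _; exists point => //; rewrite AT.
  by rewrite AT !massE ?lee_fin//; exact: closedT.
Qed.

Lemma point_space_approx (X Y : cmms R) (e : R) :
  (forall x y : X, x = y) -> (forall x y : Y, x = y) ->
  `|mass (setT : set X) - mass (setT : set Y)| <= e -> approx e X Y.
Proof.
move=> X1 Y1 XY; have e0 : 0 <= e by exact: le_trans XY.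
move: XY; rewrite ler_norml => /andP[? ?].
by exists (fun _ _ => True); split; apply: point_space_half => //; lra.
Qed.

Lemma mass_approx (X Y : cmms R) (e : R) : approx e X Y ->
  mass (setT : set X) <= mass (setT : set Y) + e.
Proof.
move=> [C [C1 _]]; rewrite (le_trans (mass_corr C1 closedT))// lerD2r.
by apply: mass_le => //; exact: (corr_closed C1 closedT).
Qed.

(** A limit would have total mass 0, whereas full support at its root forces the whole space to have
    positive mass. *)
Lemma ghp_not_complete :
  ~ complete_for (fun x y : Xc_supp R => ghp (set_val x) (set_val y)).
Proof.
move=> cpl.
have c0 n : 0 < (n.+1%:R^-1 : R) by rewrite invr_gt0.
have /choice[X XE] n := point_space_ex (c0 n).
have X1 n := (XE n).1.
have mX n : mass (setT : set (X n)) = n.+1%:R^-1 by rewrite /mass (XE n).2.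
pose w n : Xc R := (\pi_(Xc R) (X n))%qT.
have wX n e : 0 <= e -> approx e (repr (w n)) (X n) by exact: xapprox_pi.
have wS n : Xc_supp R (w n).
  apply/Xc_suppP => k.
  (* Full support is required of the chosen representative of the class, not of [X n]; the spread
     carries it over through an approximation of size 0. *)
  have s0 : 0 < spread k (X n).
    by apply/spread_gt0/point_space_support => //; rewrite (XE n).2 lte_fin.
  by have := lt_le_trans s0 (spread_lipschitz k (approx_sym (wX n 0 (lexx _)))); rewrite addr0.
pose u n : Xc_supp R := exist _ (w n) (mem_set (wS n)).
have u_cauchy : cauchy_for (fun x y : Xc_supp R => ghp (set_val x) (set_val y)) u.
  move=> e e0; have e40 : 0 < e / 4 by lra.
  have [N _ hN] := near_infty_natSinv_lt (PosNum e40).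
  exists ([set n | (N <= n)%N], [set n | (N <= n)%N]).
    by split; exists N.
  move=> [m n] /= [/hN /= Nm /hN /= Nn].
  apply: (@le_lt_trans _ _ (3 * (e / 4))); last lra.
  apply: approx_ghp_le => //.
  rewrite -[e / 4]addr0; apply: approx_trans (approx_sym (wX n 0 (lexx _))).
  rewrite -[e / 4]add0r; apply: approx_trans (wX m 0 (lexx _)) _.
  apply: point_space_approx => //; rewrite !mX ler_norml.
  have := c0 m; have := c0 n; move: Nm Nn.
  move: (m.+1%:R^-1 : R) (n.+1%:R^-1 : R) => a b.
  by move=> ? ? ? ?; apply/andP; split; lra.
have [l ul] := cpl u u_cauchy.
have ml : mass (setT : set (repr (set_val l))) <= 0.
  apply/ler_addgt0Pr => e e0; have e30 : 0 < e / 3 by lra.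
  move/cvgrPdist_lt : ul => /(_ _ e30)[N _ hN].
  have [N' _ hN'] := near_infty_natSinv_lt (PosNum e30).
  have := hN _ (leq_maxl N N'); have := hN' _ (leq_maxr N N').
  set n := maxn N N' => /= n1; rewrite sub0r normrN => /ltr_normlW un.
  have := mass_approx (approx_sym (ghp_approx un)).
  have := mass_approx (wX n _ (ltW e30)).
  by rewrite mX; move: n1; move: (n.+1%:R^-1 : R) => a; lra.
have : measure_support (repr (set_val l)) = setT.
  exact: (@set_valP _ (Xc_supp R) l).
move/seteqP => [_ h]; have := h point I setT openT I.
by rewrite massE ?lte_fin ?ltNge ?ml//; exact: closedT.
Qed.

End not_complete.

Theorem corollary5p6 (R : realType) :
  polish R (Xc_supp R) /\
  ~ complete_for (fun x y : Xc_supp R => ghp (set_val x) (set_val y)).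
Proof.
split; last exact: ghp_not_complete.
split; first exact: separable_Xc_supp.
by exists supp_dist; [exact: supp_dist_metrizes|exact: supp_dist_complete].
Qed.
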